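(* Assume (A.a) and (A.b), that $f$ is definable in some o-minimal structure, and let $\beta\in[0,1)$, $\lambda\in[0,\frac{\beta}{1-\beta}]$, and step sizes $\{\alpha_k\}_k\subset(0,\infty)$ with $\alpha_k\le\frac{(1-\beta)(1-\beta^m)}{4Lm}$ for all $k$, \[ \sum_{k=1}^\infty\alpha_k=\infty,\qquad\sum_{k=1}^\infty\alpha_k^{1+\xi}<\infty\ \text{ for some }\xi\in(0,1). \] Let the sequences be generated by RRM with arbitrary permutations, and suppose $\liminf_{k\to\infty}\|x^k\|<\infty$. Then: (a) $\{x^k\}_k$ converges to some $x^*\in\mathbb R^d$ with $\nabla f(x^* )=0$, and $\sum_{k=1}^\infty\|z^{k+1}-z^k\|<\infty$; (b) $\sum_{k=1}^\infty\alpha_k\|\nabla f(x^k)\|<\infty$ and $\big(\sum_{k=1}^T\alpha_k\big)^2\cdot\min_{k=1,\dots,T}\|\nabla f(x^k)\|^2\to0$ as $T\to\infty$.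
   Context: Let $n,d\in\mathbb N$, $f_1,\dots,f_n:\mathbb R^d\to\mathbb R$ continuously differentiable, $f:=\frac1n\sum_{i=1}^n f_i$, $[n]:=\{1,\dots,n\}$. Fix a mini-batch size $b\in\mathbb N$ with $m:=n/b\in\mathbb N$. Random reshuffling with momentum (RRM) with step sizes $\{\alpha_k\}_{k\ge1}\subset(0,\infty)$ and parameters $\beta,\lambda$ generates sequences as follows: start with $x^1=\tilde x^1\in\mathbb R^d$; for each $k=1,2,\dots$ choose a permutation $\pi^k=(\pi^k_1,\dots,\pi^k_n)$ of $[n]$, set $y_0^k=\tilde x^k$, $y_1^k=x^k$, and for $i=1,\dots,m$ compute $\hat y_i^k=y_i^k+\lambda(y_i^k-y_{i-1}^k)$, $d_i^k=\frac1b\sum_{j=(i-1)b+1}^{ib}\nabla f_{\pi^k_j}(\hat y_i^k)$, $y_{i+1}^k=y_i^k-\alpha_kd_i^k+\beta(y_i^k-y_{i-1}^k)$; then set $\tilde x^{k+1}=y_m^k$, $x^{k+1}=y_{m+1}^k$. The proxy iterates are $z^k:=\frac{1}{1-\beta}x^k-\frac{\beta}{1-\beta}\tilde x^k$. Assumption (A.a): there are $L>0$ and $\bar f\in\mathbb R$ such that each $\nabla f_i$ is $L$-Lipschitz and $f_i(x)\ge\bar f$ for all $x\in\mathbb R^d$, $i\in[n]$. Assumption (A.b): $\{\alpha_k\}_k$ is non-increasing. *)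

(* Defs.v *)
From HB Require Import structures.
From mathcomp Require Import all_boot all_order all_algebra.
From mathcomp Require Import perm.
From mathcomp Require Import all_classical all_reals all_analysis.
Set Implicit Arguments. Unset Strict Implicit. Unset Printing Implicit Defensive.
Import Order.TTheory GRing.Theory Num.Theory.
Import numFieldNormedType.Exports.
Local Open Scope classical_set_scope.
Local Open Scope ring_scope.

(** Euclidean norm on R^d (the norm of the paper; MathComp's `|.| on
    matrices is the sup norm). *)
Definition enorm (R : realType) (d : nat) (v : 'rV[R]_d) : R :=
  Num.sqrt (\sum_(j < d) v ord0 j ^+ 2).

Definition grad (R : realType) (d : nat) (f : 'rV[R]_d -> R) (x : 'rV[R]_d)
  : 'rV[R]_d := \row_(j < d) ('d f x (delta_mx ord0 j : 'rV[R]_d)).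

Definition C1 (R : realType) (d : nat) (f : 'rV[R]_d -> R) : Prop :=
  (forall x, differentiable f x) /\ continuous (grad f).

Inductive pexpr (R : Type) (n : nat) : Type :=
| PVar of 'I_n
| PConst of R
| PAdd of pexpr R n & pexpr R n
| PMul of pexpr R n & pexpr R n.

Fixpoint peval (R : realType) (n : nat) (p : pexpr R n) (x : 'rV[R]_n) : R :=
  match p with
  | PVar i => x ord0 i
  | PConst c => c
  | PAdd p q => peval p x + peval q x
  | PMul p q => peval p x * peval q x
  end.

(** O-minimal structure on (R,+,.) (cf. Attouch-Bolte-Redont-Soubeyran,
    van den Dries): a family S_n of Boolean algebras of subsets of R^n,
    stable under products with R and under projection, containing the
    algebraic sets, and such that S_1 consists of finite unions of
    (possibly unbounded) open intervals and points. *)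
Record ominimal (R : realType) (S : forall n : nat, set (set 'rV[R]_n)) : Prop := {
  om_setT : forall n, S n setT;
  om_setC : forall n (A : set 'rV[R]_n), S n A -> S n (~` A);
  om_setU : forall n (A B : set 'rV[R]_n), S n A -> S n B -> S n (A `|` B);
  om_prodR : forall n (A : set 'rV[R]_n),
      S n A -> S (n + 1)%N [set v : 'rV[R]_(n + 1) | A (lsubmx v)];
  om_prodL : forall n (A : set 'rV[R]_n),
      S n A -> S (1 + n)%N [set v : 'rV[R]_(1 + n) | A (rsubmx v)];
  om_proj : forall n (A : set 'rV[R]_(n + 1)),
      S (n + 1)%N A -> S n [set u : 'rV[R]_n | exists w : 'rV[R]_1, A (row_mx u w)];
  om_alg : forall n (p : pexpr R n), S n [set x | peval p x = 0];
  om_one : forall A : set 'rV[R]_1, S 1%N A ->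
      exists (s : seq (\bar R * \bar R)) (pts : seq R),
        A = [set v | (exists2 ab, ab \in s & (ab.1 < (v ord0 ord0)%:E < ab.2)%E)
                     \/ v ord0 ord0 \in pts]
}.

Definition graph (R : realType) (d : nat) (f : 'rV[R]_d -> R) : set 'rV[R]_(d + 1) :=
  [set v | rsubmx v ord0 ord0 = f (lsubmx v)].

Definition definable_ominimal (R : realType) (d : nat) (f : 'rV[R]_d -> R) : Prop :=
  exists S, ominimal S /\ S (d + 1)%N (graph f).

(** Random reshuffling with momentum: the sequences x, xt (= x tilde) and
    the inner iterates y k i (k >= 1, i = 0..m+1) satisfy the RRM recursion
    for permutations pi k of [n] (0-based: pi^k_j = pi k (j-1)). *)
Definition RRM (R : realType) (d n b m : nat) (fi : 'I_n -> 'rV[R]_d -> R)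
  (alpha : nat -> R) (beta lambda : R) (pi : nat -> 'S_n)
  (x xt : nat -> 'rV[R]_d) (y : nat -> nat -> 'rV[R]_d) : Prop :=
  x 1%N = xt 1%N /\
  forall k, (1 <= k)%N ->
    [/\ y k 0%N = xt k, y k 1%N = x k,
        (forall i, (1 <= i <= m)%N ->
           let yhat := y k i + lambda *: (y k i - y k i.-1) in
           let dik := b%:R^-1 *: \sum_(j < n | ((i.-1 * b)%N <= j < i * b)%N)
                                    grad (fi (pi k j)) yhat in
           y k i.+1 = y k i - alpha k *: dik + beta *: (y k i - y k i.-1)),
        xt k.+1 = y k m & x k.+1 = y k m.+1].

(* Main.v *)
(** Kurdyka's argument, in a form that needs neither derivatives nor continuity
    of definable functions.  On a ball and at a level c, let gamma(t) be the
    lexicographically least point of {f = c + t} with minimal gradient norm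
    m(t); it exists by compactness and is definable.  By o-minimality m and the
    coordinates of gamma are monotone near 0+, so v(t) = sum of +-gamma_i(t) is
    bounded and nondecreasing, and refining the mean value inequality along
    gamma gives t - s <= m(t) (v(t) - v(s)): the pair (m, v) plays the role of
    (1/phi', phi) for a desingularizing function phi.

    Along RRM, with u = x - xt, the function f(z^k) + M alpha_k |u^k|^2 decreases
    up to an error C alpha_k^3.  Replacing m(r) by min(m(r/2), (r/2)^xi) absorbs
    this error in the KL inequality at a cost of order alpha_k^(1+xi), which is
    summable.  Hence z^k has finite length, never leaves the ball once it is
    close to the limit level, and sum_k alpha_k |grad f(z^k)| is finite. *)

Require Import Defs.
From HB Require Import structures.
From mathcomp Require Import all_boot all_order all_algebra.
From mathcomp Require Import perm ring lra.
From mathcomp Require Import all_classical all_reals all_analysis.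
Import Order.TTheory GRing.Theory Num.Theory.
Import numFieldNormedType.Exports.
Set Implicit Arguments. Unset Strict Implicit. Unset Printing Implicit Defensive.
Local Open Scope classical_set_scope.
Local Open Scope ring_scope.

(** Momentum cancels in the proxy [z]: over one epoch [z] moves by a multiple of a sum in which each
    component gradient occurs once, so the epoch is a gradient step for f of length alpha_k m / (1 -
    beta), with an error of that length times O(|u^k| + alpha_k sqrt(f(z^k) - fbar)). Gradients have
    no a priori bound; the lower bound [fbar] replaces it through |grad f_i|^2 <= 4 L n (f - fbar),
    so the errors are multiplicative and a Gronwall argument bounds the sequence. What remains at
    index k is O(alpha_k), because by monotonicity the tail of the cubes is at most alpha_k times
    the sum of squares. Raised to the power xi in the KL inequality and multiplied by a step of
    order alpha_k, it gives alpha_k^(1+xi).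

    The liminf only puts infinitely many iterates in some ball. The KL inequality is therefore used
    on a ball with radius larger by one, from an index so late that the remaining length is below
    one. The gradient norm is shown definable without differentiating: for a Lipschitz gradient,
    |grad f(x)| <= s is equivalent to a quantified inequality between values of f. *)

(** * Definable predicates *)

(* A type with coordinates in R^cdim.  Definability of predicates over such
   types turns the closure axioms of an o-minimal structure into rules for
   connectives and quantifiers that apply by unification. *)
Record ctx (R : realType) := Ctx {
  csort :> Type;
  cdim : nat;
  cdec : 'rV[R]_cdim -> csort;
  cenc : csort -> 'rV[R]_cdim;
  cencK : cancel cenc cdec;
  cdecK : cancel cdec cenc }.

Section Contexts.
Variable R : realType.

Lemma scal_encK : cancel (fun a : R => const_mx a : 'rV[R]_1) (fun v => v ord0 ord0).
Proof. by move=> a; rewrite mxE. Qed.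
Lemma scal_decK : cancel (fun v : 'rV[R]_1 => v ord0 ord0) (fun a : R => const_mx a).
Proof. by move=> v; apply/rowP => i; rewrite mxE (ord1 i). Qed.
Canonical ctx_scal : ctx R := Ctx scal_encK scal_decK.

Lemma vec_encK d : cancel (fun v : 'rV[R]_d => v) (fun v => v).
Proof. by []. Qed.
Canonical ctx_vec d : ctx R := Ctx (@vec_encK d) (@vec_encK d).

Lemma prod_encK (T U : ctx R) :
  cancel (fun p : T * U => row_mx (cenc p.1) (cenc p.2))
         (fun v => (cdec (lsubmx v), cdec (rsubmx v))).
Proof. by move=> [t u] /=; rewrite row_mxKl row_mxKr !cencK. Qed.
Lemma prod_decK (T U : ctx R) :
  cancel (fun v => (cdec (lsubmx v), cdec (rsubmx v)))
         (fun p : T * U => row_mx (cenc p.1) (cenc p.2)).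
Proof. by move=> v /=; rewrite !cdecK hsubmxK. Qed.
Canonical ctx_prod (T U : ctx R) : ctx R := Ctx (@prod_encK T U) (@prod_decK T U).

(** Syntactic on purpose: a witness in [pexpr] is what [om_alg] accepts. *)
Definition polyfun (T : ctx R) (s : T -> R) :=
  exists p : pexpr R (cdim T), forall v, s (cdec v) = peval p v.

Fixpoint prename n k (h : 'I_n -> 'I_k) (p : pexpr R n) : pexpr R k :=
  match p with
  | PVar i => PVar R (h i)
  | PConst c => PConst k c
  | PAdd p q => PAdd (prename h p) (prename h q)
  | PMul p q => PMul (prename h p) (prename h q)
  end.

Lemma peval_prename n k (h : 'I_n -> 'I_k) p (v : 'rV[R]_k) :
  peval (prename h p) v = peval p (\row_i v ord0 (h i)).
Proof. by elim: p => //= [i|p -> q ->|p -> q ->] //; rewrite mxE. Qed.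

Lemma polyfun_cst (T : ctx R) c : polyfun (fun _ : T => c).
Proof. by exists (PConst _ c). Qed.

Lemma polyfun_add (T : ctx R) (s t : T -> R) :
  polyfun s -> polyfun t -> polyfun (fun x => s x + t x).
Proof. by move=> [p sp] [q tq]; exists (PAdd p q) => v; rewrite sp tq. Qed.

Lemma polyfun_mul (T : ctx R) (s t : T -> R) :
  polyfun s -> polyfun t -> polyfun (fun x => s x * t x).
Proof. by move=> [p sp] [q tq]; exists (PMul p q) => v; rewrite sp tq. Qed.

Lemma polyfun_opp (T : ctx R) (s : T -> R) :
  polyfun s -> polyfun (fun x => - s x).
Proof.
move=> hs; rewrite (_ : (fun _ => _) = (fun x => -1 * s x)); last first.
  by apply/funext => x; rewrite mulN1r.
by apply: polyfun_mul => //; exact: polyfun_cst.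
Qed.

Lemma polyfun_sqr (T : ctx R) (s : T -> R) :
  polyfun s -> polyfun (fun x => s x ^+ 2).
Proof. by move=> hs; apply: polyfun_mul. Qed.

Lemma polyfun_sum (T : ctx R) (I : Type) (r : seq I) (s : I -> T -> R) :
  (forall i, polyfun (s i)) -> polyfun (fun x => \sum_(i <- r) s i x).
Proof.
move=> hs; elim: r => [|i r IH].
  rewrite (_ : (fun _ => _) = (fun=> 0)); first exact: polyfun_cst.
  by apply/funext => x; rewrite big_nil.
rewrite (_ : (fun _ => _) = (fun x => s i x + \sum_(j <- r) s j x)).
  exact: polyfun_add.
by apply/funext => x; rewrite big_cons.
Qed.

(** Stated by pulling back polynomial functions, so that projections out of nested contexts compose
    without mentioning coordinates; [polymapP] recovers the coordinate form. *)
Definition polymap (T U : ctx R) (h : T -> U) :=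
  forall s : U -> R, polyfun s -> polyfun (fun t => s (h t)).

Lemma polyfun_comp (T U : ctx R) (s : U -> R) (h : T -> U) :
  polyfun s -> polymap h -> polyfun (fun t => s (h t)).
Proof. by move=> ps; exact. Qed.

Lemma polymap_id (T : ctx R) : polymap (fun t : T => t).
Proof. by []. Qed.

Lemma polymap_fst (T U V : ctx R) (h : T -> ctx_prod U V) :
  polymap h -> polymap (fun t => (h t).1).
Proof.
move=> ph s [p sp]; apply: (ph (fun x => s x.1)).
exists (prename (lshift _) p) => v /=.
by rewrite peval_prename sp; congr peval; apply/rowP => i; rewrite !mxE.
Qed.

Lemma polymap_snd (T U V : ctx R) (h : T -> ctx_prod U V) :
  polymap h -> polymap (fun t => (h t).2).
Proof.
move=> ph s [p sp]; apply: (ph (fun x => s x.2)).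
exists (prename (@rshift _ _) p) => v /=.
by rewrite peval_prename sp; congr peval; apply/rowP => i; rewrite !mxE.
Qed.

Lemma polyfun_id : polyfun (T := ctx_scal) (fun t => t).
Proof. by exists (PVar R ord0). Qed.

Lemma polyfun_fst (T U : ctx R) (h : T -> ctx_prod ctx_scal U) :
  polymap h -> polyfun (fun t => (h t).1).
Proof. by move=> ph; exact: (polymap_fst ph polyfun_id). Qed.

Lemma polyfun_snd (T U : ctx R) (h : T -> ctx_prod U ctx_scal) :
  polymap h -> polyfun (fun t => (h t).2).
Proof. by move=> ph; exact: (polymap_snd ph polyfun_id). Qed.

Lemma polyfun_coord (T : ctx R) d (h : T -> ctx_vec d) j :
  polymap h -> polyfun (fun t => h t ord0 j).
Proof. by move=> ph; apply: (ph (fun v => v ord0 j)); exists (PVar R j). Qed.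

Lemma polyfun_enc (T : ctx R) j : polyfun (fun t : T => cenc t ord0 j).
Proof. by exists (PVar R j) => v; rewrite cdecK. Qed.

Lemma polymapP (T U : ctx R) (h : T -> U) :
  (forall j, polyfun (fun t => cenc (h t) ord0 j)) -> polymap h.
Proof.
move=> ph s [p sp]; rewrite (_ : (fun t => _) = (fun t => peval p (cenc (h t)))).
  elim: p {sp} => [i|c|p IHp q IHq|p IHp q IHq] /=; first exact: ph.
  - exact: polyfun_cst.
  - exact: polyfun_add.
  - exact: polyfun_mul.
by apply/funext => t; rewrite -sp cencK.
Qed.

Lemma polymap_scal (T : ctx R) (s : T -> R) : polyfun s -> polymap (s : T -> ctx_scal).
Proof.
by move=> ps; apply: polymapP => j /=; under eq_fun do rewrite mxE.
Qed.

Lemma polymap_pair (T U V : ctx R) (h : T -> U) (h' : T -> V) :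
  polymap h -> polymap h' -> polymap (fun t => (h t, h' t) : ctx_prod U V).
Proof.
move=> ph ph'; apply: polymapP => j /=; under eq_fun do rewrite mxE.
case: splitP => i _; [apply: (ph (fun u => cenc u ord0 i))|
  apply: (ph' (fun u => cenc u ord0 i))]; exact: polyfun_enc.
Qed.

End Contexts.

Ltac polyfun_tac := repeat first
  [ apply: polyfun_cst | apply: polyfun_add | apply: polyfun_opp
  | apply: polyfun_mul | apply: polyfun_sqr | apply: polyfun_sum => ?
  | apply: polyfun_fst | apply: polyfun_snd | apply: polyfun_id
  | apply: polyfun_coord | apply: polymap_fst | apply: polymap_snd
  | apply: polymap_id ].


Section Definable.
Variables (R : realType) (S : forall n : nat, set (set 'rV[R]_n)).
Hypothesis omS : ominimal S.

Definition dfn (T : ctx R) (P : T -> Prop) : Prop := S [set v | P (cdec v)].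

Lemma om_cast n k (e : n = k) (A : set 'rV[R]_k) :
  S [set v : 'rV[R]_n | A (castmx (erefl, e) v)] -> S A.
Proof. by subst k; rewrite /= (_ : [set v | _] = A). Qed.

Lemma dfn_ext (T : ctx R) (P Q : T -> Prop) :
  (forall t, P t <-> Q t) -> dfn P -> dfn Q.
Proof.
move=> PQ; rewrite /dfn (_ : [set v | P _] = [set v | Q (cdec v)]) //.
by apply/seteqP; split => v /= /PQ.
Qed.

Lemma dfn_not (T : ctx R) (P : T -> Prop) : dfn P -> dfn (fun t => ~ P t).
Proof. exact: om_setC. Qed.

Lemma dfn_or (T : ctx R) (P Q : T -> Prop) :
  dfn P -> dfn Q -> dfn (fun t => P t \/ Q t).
Proof. exact: om_setU. Qed.

Lemma dfn_and (T : ctx R) (P Q : T -> Prop) :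
  dfn P -> dfn Q -> dfn (fun t => P t /\ Q t).
Proof.
move=> hP hQ; apply: (dfn_ext (P := fun t => ~ (~ P t \/ ~ Q t))).
  by move=> t; rewrite not_orP !notK.
by apply: dfn_not; apply: dfn_or; exact: dfn_not.
Qed.

Lemma dfn_imp (T : ctx R) (P Q : T -> Prop) :
  dfn P -> dfn Q -> dfn (fun t => P t -> Q t).
Proof.
move=> hP hQ; apply: (dfn_ext (P := fun t => ~ P t \/ Q t)).
  by move=> t; rewrite implyE.
by apply: dfn_or => //; exact: dfn_not.
Qed.

Lemma dfn_cst (T : ctx R) (P : Prop) : dfn (fun _ : T => P).
Proof.
have [p|np] := pselect P.
  by apply: (dfn_ext (P := fun=> True)) => //; exact: om_setT.
apply: (dfn_ext (P := fun=> ~ True)); first by move=> _; split.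
by apply: dfn_not; exact: om_setT.
Qed.

Lemma dfn_ex (T : ctx R) (P : T -> R -> Prop) :
  dfn (fun p : ctx_prod T (ctx_scal R) => P p.1 p.2) -> dfn (fun t => exists a, P t a).
Proof.
move/(om_proj omS); rewrite /dfn; congr (S _); apply/seteqP; split => u /= [w].
  by rewrite row_mxKl row_mxKr => Pw; eexists; exact: Pw.
by move=> Pw; exists (const_mx w); rewrite row_mxKl row_mxKr mxE.
Qed.

Lemma dfn_all (T : ctx R) (P : T -> R -> Prop) :
  dfn (fun p : ctx_prod T (ctx_scal R) => P p.1 p.2) -> dfn (fun t => forall a, P t a).
Proof.
move=> hP; apply: (dfn_ext (P := fun t => ~ exists a, ~ P t a)).
  by move=> t; rewrite -forallNP; split => h a; have := h a; rewrite notK.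
by apply: dfn_not; apply: dfn_ex; exact: dfn_not.
Qed.

Lemma dfn_eq (T : ctx R) (s t : T -> R) :
  polyfun s -> polyfun t -> dfn (fun x => s x = t x).
Proof.
move=> hs ht; have [p sp] := polyfun_add hs (polyfun_opp ht).
apply: (dfn_ext (P := fun x => s x - t x = 0)).
  by move=> x; split => [/eqP|->]; rewrite ?subrr // subr_eq0 => /eqP.
rewrite /dfn (_ : [set v | _] = [set v | peval p v = 0]); first exact: om_alg.
by apply/seteqP; split => v /=; rewrite sp.
Qed.

(** The order comes out of the field operations: a real is nonnegative exactly when it is a square,
    so the comparison is the projection of an algebraic set. *)
Lemma dfn_le (T : ctx R) (s t : T -> R) :
  polyfun s -> polyfun t -> dfn (fun x => s x <= t x).
Proof.
move=> hs ht; apply: (dfn_ext (P := fun x => exists a, t x - s x = a * a)).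
  move=> x; split => [[a]|st]; first by rewrite -subr_ge0 -expr2 => ->; rewrite sqr_ge0.
  by exists (Num.sqrt (t x - s x)); rewrite -expr2 sqr_sqrtr // subr_ge0.
apply: dfn_ex; apply: dfn_eq; last by polyfun_tac.
apply: polyfun_add; last apply: polyfun_opp.
  exact: (polymap_fst (polymap_id (T := ctx_prod T (ctx_scal R))) ht).
exact: (polymap_fst (polymap_id (T := ctx_prod T (ctx_scal R))) hs).
Qed.

Lemma dfn_lt (T : ctx R) (s t : T -> R) :
  polyfun s -> polyfun t -> dfn (fun x => s x < t x).
Proof.
move=> hs ht; apply: (dfn_ext (P := fun x => ~ (t x <= s x))).
  by move=> x; rewrite ltNge; split => /negP.
by apply: dfn_not; exact: dfn_le.
Qed.

Lemma dfn_forall_in (T : ctx R) (I : eqType) (r : seq I) (P : I -> T -> Prop) :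
  (forall i, dfn (P i)) -> dfn (fun t => forall i, i \in r -> P i t).
Proof.
move=> hP; elim: r => [|i r IH].
  by apply: (dfn_ext (P := fun=> True)) => //; exact: dfn_cst.
apply: (dfn_ext (P := fun t => P i t /\ forall j, j \in r -> P j t)).
  move=> t; split => [[Pi Pr] j|h].
    by rewrite inE => /predU1P[->//|/Pr].
  by split => [|j jr]; apply: h; rewrite inE ?eqxx ?jr ?orbT.
exact: dfn_and.
Qed.

Lemma dfn_forall_ord (T : ctx R) d (P : 'I_d -> T -> Prop) :
  (forall i, dfn (P i)) -> dfn (fun t => forall i, P i t).
Proof.
move=> hP; apply: (dfn_ext _ (dfn_forall_in (index_enum 'I_d) hP)) => t.
by split => h i; [apply: h; rewrite mem_index_enum|move=> _; exact: h].
Qed.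

(** [om_proj] removes the last coordinate, so the induction peels off the end of the second block.
    The work is the transport along n + k.+1 = n + k + 1, which is not a conversion. *)
Lemma om_projn n k (A : set 'rV[R]_(n + k)) :
  S A -> S [set u : 'rV[R]_n | exists w : 'rV[R]_k, A (row_mx u w)].
Proof.
elim: k A => [|k IH] A SA.
  apply: (@om_cast (n + 0)%N n (addn0 n)).
  rewrite (_ : [set v | _] = A) //; apply/seteqP; split => v /=.
    move=> [w]; congr A; apply/rowP => i; rewrite !mxE.
    case: splitP => j ij; last by case: j ij.
    by rewrite castmxE /=; congr (v _ _); apply/val_inj.
  move=> Av; exists (0 : 'rV_0); move: Av; congr A; apply/rowP => i; rewrite !mxE.
  case: splitP => j ij; last by case: j ij.
  by rewrite castmxE /=; congr (v _ _); apply/val_inj.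
have e : (n + k.+1)%N = (n + k + 1)%N by rewrite addnS addn1.
have e' : (k + 1 = k.+1)%N by rewrite addn1.
(* Reassociates the blocks [u], [w], [a]; the cases are the blocks into which an index falls on
   either side. *)
have rE (u : 'rV[R]_n) (w : 'rV[R]_k) (a : 'rV[R]_1) :
    castmx (erefl, esym e) (row_mx (row_mx u w) a) =
    row_mx u (castmx (erefl, e') (row_mx w a)).
  apply/rowP => i; rewrite castmxE cast_ord_id !mxE.
  case: splitP => j ij; case: splitP => l il; rewrite ?castmxE ?cast_ord_id ?mxE.
  - case: splitP => o jo; first by congr (u _ _); apply/val_inj; rewrite /= -jo -ij.
    by have := ltn_ord l; rewrite -il /= in ij *; rewrite ij jo -ltn_subRL subnn.
  - case: splitP => o jo; last case: splitP => q /= lq.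
    + by have := ltn_ord o; rewrite -jo -ij /= il -ltn_subRL subnn.
    + by congr (w _ _); apply/val_inj/(@addnI n); rewrite -jo -ij /= il lq.
    + by have := ltn_ord o; rewrite -(ltn_add2l n) -jo -ij /= il lq ltnNge leq_add2l leq_addr.
  - by have := ltn_ord l; rewrite -il /= in ij *; rewrite ij -addnA -ltn_subRL subnn.
  - case: splitP => o /= lo.
      have := ltn_ord o; rewrite -lo -(ltn_add2l n) -il /= in ij *.
      by rewrite ij -ltn_subRL subnn.
    by rewrite !ord1.
have : S [set v : 'rV[R]_(n + k + 1) | A (castmx (erefl, esym e) v)].
  apply: (@om_cast _ _ e); rewrite (_ : [set v | _] = A) //.
  by apply/seteqP; split => v /=; rewrite castmx_comp /= castmx_id.
move/(om_proj omS)/IH; congr S; apply/seteqP; split => u /=.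
  by move=> [w [a]]; rewrite rE => Aw; eexists; exact: Aw.
move=> [w Aw].
exists (lsubmx (castmx (erefl, esym e') w)), (rsubmx (castmx (erefl, esym e') w)).
by rewrite rE hsubmxK castmx_comp castmx_id.
Qed.

(** On this side the induction is free of casts: n.+1 + k reduces to 1 + (n + k), the shape of
    [om_prodL]. *)
Lemma om_prodLn n k (A : set 'rV[R]_k) :
  S A -> S [set v : 'rV[R]_(n + k) | A (rsubmx v)].
Proof.
move=> SA; elim: n => [|n IH].
  rewrite (_ : [set v | _] = A) //; apply/seteqP; split => v /=; congr A;
    by apply/rowP => i; rewrite mxE; congr (v _ _); apply/val_inj.
move: (om_prodL omS IH); congr (S _); apply/seteqP; split => v /=; congr A;
  by apply/rowP => i; rewrite !mxE; congr (v _ _); apply/val_inj.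
Qed.

Lemma dfn_exV (T : ctx R) d (P : T -> 'rV[R]_d -> Prop) :
  dfn (fun p : ctx_prod T (ctx_vec R d) => P p.1 p.2) ->
  dfn (fun t => exists a, P t a).
Proof.
move/om_projn; rewrite /dfn; congr (S _); apply/seteqP; split => u /= [w];
  by rewrite ?row_mxKl ?row_mxKr => Pw; exists w; rewrite ?row_mxKl ?row_mxKr.
Qed.

Lemma dfn_allV (T : ctx R) d (P : T -> 'rV[R]_d -> Prop) :
  dfn (fun p : ctx_prod T (ctx_vec R d) => P p.1 p.2) ->
  dfn (fun t => forall a, P t a).
Proof.
move=> hP; apply: (dfn_ext (P := fun t => ~ exists a, ~ P t a)).
  by move=> t; rewrite -forallNP; split => h a; have := h a; rewrite notK.
by apply: dfn_not; apply: dfn_exV; exact: dfn_not.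
Qed.

(** The preimage is the projection of the graph of [h], which is algebraic, intersected with the
    cylinder over [A]. *)
Lemma dfn_pull (T : ctx R) k (A : set 'rV[R]_k) (h : T -> 'rV[R]_k) :
  S A -> (forall j, polyfun (fun t => h t ord0 j)) -> dfn (fun t => A (h t)).
Proof.
move=> SA hh.
apply: (dfn_ext (P := fun t => exists w : 'rV[R]_k, (forall j, h t ord0 j = w ord0 j) /\ A w)).
  move=> t; split => [[w [/rowP <-]]//|At]; by exists (h t).
apply: dfn_exV; apply: dfn_and; last exact: om_prodLn.
apply: dfn_forall_ord => j; apply: dfn_eq; last by polyfun_tac.
exact: (polymap_fst (polymap_id (T := ctx_prod T (ctx_vec R k))) (hh j)).
Qed.

Definition dfn_fun d (f : 'rV[R]_d -> R) :=
  dfn (fun p : ctx_prod (ctx_vec R d) (ctx_scal R) => f p.1 = p.2).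

Lemma dfn_fun_graph d (f : 'rV[R]_d -> R) : S (graph f) -> dfn_fun f.
Proof.
rewrite /dfn_fun /dfn /graph; congr (S _); apply/seteqP; split => v /=;
  by move=> ->.
Qed.

Lemma dfn_subst (T U : ctx R) (P : U -> Prop) (h : T -> U) :
  dfn P -> polymap h -> dfn (fun t => P (h t)).
Proof.
move=> hP ph.
apply: (dfn_ext (P := fun t => [set v | P (cdec v)] (cenc (h t)))).
  by move=> t /=; rewrite cencK.
by apply: dfn_pull => // j; apply: (ph (fun u => cenc u ord0 j)); exact: polyfun_enc.
Qed.

Lemma dfn_subst2 (T U V : ctx R) (P : U -> V -> Prop) (h : T -> U) (h' : T -> V) :
  dfn (fun p : ctx_prod U V => P p.1 p.2) -> polymap h -> polymap h' ->
  dfn (fun t => P (h t) (h' t)).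
Proof. by move=> hP ph ph'; apply: (dfn_subst hP (polymap_pair ph ph')). Qed.

End Definable.

(** * Germs at 0+ and the monotonicity theorem *)

Section Germ.
Variable R : realType.

(** Germs at 0+, with an explicit radius instead of a filter: in this form the property is
    first-order and can itself be proved definable. *)
Definition nearly (P : R -> Prop) := exists2 e : R, 0 < e & forall t, 0 < t < e -> P t.

Lemma nearly_and (P Q : R -> Prop) :
  nearly P -> nearly Q -> nearly (fun t => P t /\ Q t).
Proof.
move=> [e e0 Pe] [e' e'0 Qe]; exists (Num.min e e'); first by rewrite lt_min e0.
move=> t; rewrite lt_min => /and3P[t0 te te'].
by split; [apply: Pe|apply: Qe]; rewrite t0.
Qed.

Lemma nearlyW (P Q : R -> Prop) : (forall t, P t -> Q t) -> nearly P -> nearly Q.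
Proof. by move=> PQ [e e0 Pe]; exists e => // t /Pe /PQ. Qed.

Lemma nearly_ex (P : R -> Prop) : nearly P -> exists t, P t.
Proof. by move=> [e e0]; move/(_ (e / 2)) => h; exists (e / 2); apply: h; lra. Qed.

Lemma nearly_forall_ord d (P : 'I_d -> R -> Prop) :
  (forall i, nearly (P i)) -> nearly (fun t => forall i, P i t).
Proof.
move=> hP.
suff : nearly (fun t => forall i, i \in enum 'I_d -> P i t).
  by apply: nearlyW => t h i; apply: h; rewrite mem_enum.
elim: (enum 'I_d) => [|i s IH]; first by exists 1.
apply: (nearlyW _ (nearly_and (hP i) IH)) => t [Pi Ps] j.
by rewrite inE => /predU1P[->//|/Ps].
Qed.

Lemma nearly_interval (a b : \bar R) :
  nearly (fun t => (a < t%:E < b)%E) \/ nearly (fun t => ~ (a < t%:E < b)%E).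
Proof.
have ha : nearly (fun t => (a < t%:E)%E) \/ nearly (fun t => ~ (a < t%:E)%E).
  case: a => [a| |]; last by left; exists 1 => // t _; rewrite ltNyr.
    case: (leP a 0) => a0.
      by left; exists 1 => // t; rewrite lte_fin; lra.
    by right; exists a => // t; rewrite lte_fin; lra.
  by right; exists 1.
have hb : nearly (fun t => (t%:E < b)%E) \/ nearly (fun t => ~ (t%:E < b)%E).
  case: b => [b| |]; last by right; exists 1.
    case: (ltP 0 b) => b0.
      by left; exists b => // t; rewrite lte_fin; lra.
    by right; exists 1 => // t; rewrite lte_fin; lra.
  by left; exists 1 => // t _; rewrite ltry.
case: ha => ha; last by right; apply: nearlyW ha => t nt /andP[].
case: hb => hb; last by right; apply: nearlyW hb => t nt /andP[].
by left; apply: (nearlyW _ (nearly_and ha hb)) => t [-> ->].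
Qed.

Lemma nearly_seq (I : eqType) (Q : I -> R -> Prop) (s : seq I) :
  (forall i, nearly (Q i) \/ nearly (fun t => ~ Q i t)) ->
  nearly (fun t => exists2 i, i \in s & Q i t) \/
  nearly (fun t => ~ exists2 i, i \in s & Q i t).
Proof.
move=> hQ; elim: s => [|i s IH]; first by right; exists 1 => // t _ [].
case: (hQ i) => hi.
  by left; apply: nearlyW hi => t Qi; exists i; rewrite ?inE ?eqxx.
case: IH => IH.
  by left; apply: nearlyW IH => t [j js Qj]; exists j; rewrite ?inE ?js ?orbT.
right; apply: (nearlyW _ (nearly_and hi IH)) => t [ni ns] [j].
by rewrite inE => /predU1P[->//|js Qj]; apply: ns; exists j.
Qed.

Lemma nearly_point (a : R) : nearly (fun t => t = a) \/ nearly (fun t => t <> a).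
Proof.
right; case: (leP a 0) => a0; first by exists 1 => // t; lra.
by exists a => // t; lra.
Qed.

Section OMin.
Variables (S : forall n : nat, set (set 'rV[R]_n)).
Hypothesis omS : ominimal S.
Notation dfn := (dfn S).
Notation scal := (ctx_scal R).

(** The only use of [om_one]. Each of the finitely many intervals and points is decided near 0+,
    hence so is their union. *)
Lemma dfn_nearly (P : R -> Prop) : dfn (T := scal) P ->
  nearly P \/ nearly (fun t => ~ P t).
Proof.
move=> /(om_one omS)[s [pts /seteqP[sub sup]]].
have PE t : P t <-> (exists2 ab, ab \in s & (ab.1 < t%:E < ab.2)%E) \/
    (exists2 a, a \in pts & t = a).
  split => [Pt|Pt].
    have /= := sub (const_mx t); rewrite mxE => /(_ Pt)[|tp]; first by left.
    by right; exists t.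
  have /= := sup (const_mx t); rewrite mxE; apply.
  by case: Pt => [|[a ap ->]]; [left|right].
have [hs|hs] := nearly_seq (Q := fun ab t => (ab.1 < t%:E < ab.2)%E) s
    (fun ab => nearly_interval ab.1 ab.2).
  by left; apply: nearlyW hs => t ht; apply/PE; left.
have [hp|hp] := nearly_seq (Q := fun a t => t = a) pts nearly_point.
  by left; apply: nearlyW hp => t ht; apply/PE; right.
by right; apply: (nearlyW _ (nearly_and hs hp)) => t [h1 h2] /PE[].
Qed.

Definition dfn_fun1 (g : R -> R) :=
  dfn (fun p : ctx_prod scal scal => g p.1 = p.2).

(** Atoms admit only polynomial terms, so the values of [g] are named by quantified variables tied
    to its graph. *)
Lemma dfn_fun1_rel (T : ctx R) (g : R -> R) (s t : T -> R) (Q : R -> R -> Prop) :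
  dfn_fun1 g -> polyfun s -> polyfun t ->
  dfn (fun p : ctx_prod scal scal => Q p.1 p.2) ->
  dfn (fun x => Q (g (s x)) (g (t x))).
Proof.
move=> hg hs ht hQ.
apply: (dfn_ext (P := fun x => exists a, exists b,
    (g (s x) = a /\ g (t x) = b) /\ Q a b)).
  move=> x; split => [[a [b [[-> ->]]]]//|Qx].
  by exists (g (s x)), (g (t x)).
apply: dfn_ex => //; apply: dfn_ex => //; apply: dfn_and => //; first apply: dfn_and => //.
- apply: (dfn_subst2 (P := fun a b => g a = b) omS hg); apply: polymap_scal; last by polyfun_tac.
  by apply: (polyfun_comp hs); polyfun_tac.
- apply: (dfn_subst2 (P := fun a b => g a = b) omS hg); apply: polymap_scal; last by polyfun_tac.
  by apply: (polyfun_comp ht); polyfun_tac.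
- by apply: (dfn_subst2 omS hQ); apply: polymap_scal; polyfun_tac.
Qed.

End OMin.
End Germ.

Section Monotonicity.
Variable R : realType.

(** Comparisons on both sides of each point replace continuity: the left one carries the bound by
    [g a] to the supremum of the range where it persists, the right one pushes it beyond. *)
Lemma locally_nondecreasing (g : R -> R) (e : R) :
  (forall x, 0 < x < e -> nearly (fun t => g (x - t) <= g x) /\
                          nearly (fun t => g x <= g (x + t))) ->
  forall a b, 0 < a -> a <= b -> b < e -> g a <= g b.
Proof.
move=> hg a b a0 ab be.
pose A := [set u | a <= u <= b /\ forall w, a <= w <= u -> g a <= g w].
have Aa : A a.
  split=> [|w /andP[w1 w2]]; first by rewrite lexx.
  by rewrite (@le_anti _ _ a w) ?w1 ?w2.
have ubA : has_ubound A by exists b => u [/andP[]].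
have supA : has_sup A by split; first by exists a.
set s := sup A.
have as_ : a <= s by apply: ub_le_sup.
have sb : s <= b by apply: ge_sup; [exists a|move=> u [/andP[]]].
have s0e : 0 < s < e by lra.
have [[d d0 hl] [d' d'0 hr]] := hg s s0e.
have before w : a <= w < s -> g a <= g w.
  move=> /andP[aw ws]; have [|u [uab hu] wu] := @sup_adherent _ A (s - w) _ supA.
    by lra.
  apply: hu; rewrite aw /=; move: wu; rewrite -/s; lra.
have gas : g a <= g s.
  have [/eqP <-//|sa] := boolP (s == a); have sa' : a < s by lra.
  have [u Au us] := sup_adherent d0 supA.
  have {}us : s - d < u by [].
  have us' : u <= s by apply: ub_le_sup.
  have [/eqP <-|us1] := boolP (u == s).
    by case: Au => uab; apply; case/andP: uab => ->; rewrite lexx.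
  apply: (@le_trans _ _ (g u)).
    by apply: before; case: Au => /andP[-> _] _; lra.
  by have := hl (s - u); rewrite subKr; apply; lra.
have [/eqP <-//|sb'] := boolP (s == b).
have sb2 : s < b by lra.
pose u := Num.min (s + d' / 2) b.
have us : s < u by rewrite lt_min sb2 andbT; lra.
have ud : u < s + d' by rewrite gt_min; apply/orP; left; lra.
have ub : u <= b by rewrite ge_min lexx orbT.
have Au : A u.
  split; first lra.
  move=> w /andP[aw wu]; have [ws|sw] := ltP w s; first by apply: before; lra.
  have [/eqP <-//|sw'] := boolP (s == w).
  apply: (le_trans gas); have := hr (w - s); rewrite subrKC; apply; lra.
by have := ub_le_sup ubA Au; rewrite -/s; lra.
Qed.

(* Two strict local minima that are minimal in a common window coincide, so
   there are only countably many of them. *)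
Lemma not_all_strict_local_min (g : R -> R) (e : R) : 0 < e ->
  ~ (forall x, 0 < x < e -> nearly (fun t => g x < g (x - t)) /\
                            nearly (fun t => g x < g (x + t))).
Proof.
move=> e0 hg.
have H x : exists n : nat, 0 < x < e -> forall t, 0 < t < n.+1%:R^-1 ->
    g x < g (x - t) /\ g x < g (x + t).
  have [x0e|] := boolP (0 < x < e); last by exists 0%N.
  have [hl hr] := hg x x0e; have [d d0 hd] := nearly_and hl hr.
  have [n hn] := ltr_add_invr d0; exists n => _ t /andP[t0 tn].
  by apply: hd; rewrite t0 /=; apply: lt_trans tn _; move: hn; rewrite add0r.
have [N hN] := choice H.
have K x y : 0 < x < e -> 0 < y < e -> N x = N y -> x < y ->
    y - x < (N y).+1%:R^-1 -> False.
  move=> x0e y0e Nxy xy yx; have t0 : 0 < y - x < (N y).+1%:R^-1 by rewrite yx subr_gt0 xy.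
  have [] := hN y y0e _ t0; rewrite subKr => g1 _.
  have [] := hN x x0e (y - x); rewrite ?Nxy // subrKC => _ g2.
  by move: (lt_trans g1 g2); rewrite ltxx.
have : countable (`]0, e[%classic : set R).
  apply/countable_injP.
  (* A point is coded by its window index and its cell in the grid of that mesh. Points with equal
     codes lie in a common window, so [K] makes the code injective; but an interval of positive
     measure is not countable. *)
  exists (fun x => pickle (N x, Num.floor (x * (N x).+1%:R))).
  move=> x y; rewrite !inE /= !in_itv /= => x0e y0e.
  move/(pcan_inj pickleK) => [Nxy].
  have := floor_itv (x * (N x).+1%:R); have := floor_itv (y * (N y).+1%:R).
  move=> + + fxy; rewrite fxy Nxy intrD; set z := (Num.floor _)%:~R.
  move=> hy hx.
  have M0 : 0 < (N y).+1%:R :> R by rewrite ltr0n.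
  have [xy|yx|//] := ltgtP x y.
    exfalso; apply: (K x y) => //.
    by rewrite -[ltRHS]mul1r ltr_pdivlMr // mulrBl; move: hx hy; rewrite mulr1z; lra.
  exfalso; apply: (K y x) => //.
  by rewrite Nxy -[ltRHS]mul1r ltr_pdivlMr // mulrBl; move: hx hy; rewrite mulr1z; lra.
move/countable_lebesgue_measure0; rewrite lebesgue_measure_itv /= lte_fin e0 sube0.
by case=> e0'; move: e0; rewrite e0' ltxx.
Qed.

Section OMin.
Variables (S : forall n : nat, set (set 'rV[R]_n)).
Hypothesis omS : ominimal S.
Notation dfn := (dfn S).
Notation scal := (ctx_scal R).

(** With [c] equal to -1 or 1 this treats the germs to the left and to the right of [x] together. *)
Lemma dfn_germ (g : R -> R) (Q : R -> R -> Prop) (c : R) :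
  dfn_fun1 S g -> dfn (fun p : ctx_prod scal scal => Q p.1 p.2) ->
  dfn (T := scal) (fun x => nearly (fun t => Q (g x) (g (x + c * t)))).
Proof.
move=> hg hQ.
apply: (dfn_ext (P := fun x => exists e, 0 < e /\
    forall t, (0 < t /\ t < e) -> Q (g x) (g (x + c * t)))).
  move=> x; split => [[e [e0 h]]|[e e0 h]].
    by exists e => // t /andP[? ?]; exact: h.
  by exists e; split => // t [t0 te]; apply: h; rewrite t0.
apply: dfn_ex => //; apply: dfn_and => //; first by apply: dfn_lt => //; polyfun_tac.
apply: dfn_all => //; apply: dfn_imp => //.
  by apply: dfn_and => //; apply: dfn_lt => //; polyfun_tac.
by apply: (dfn_fun1_rel (Q := Q) omS hg _ _ hQ); polyfun_tac.
Qed.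

Lemma dfn_germ_sign (g : R -> R) (c : R) : dfn_fun1 S g ->
  [\/ nearly (fun x => nearly (fun t => g x < g (x + c * t))),
      nearly (fun x => nearly (fun t => g x = g (x + c * t))) |
      nearly (fun x => nearly (fun t => g (x + c * t) < g x))].
Proof.
move=> hg.
have dlt : dfn (fun p : ctx_prod scal scal => p.1 < p.2) by apply: dfn_lt => //; polyfun_tac.
have deq : dfn (fun p : ctx_prod scal scal => p.1 = p.2) by apply: dfn_eq => //; polyfun_tac.
have dgt : dfn (fun p : ctx_prod scal scal => p.2 < p.1) by apply: dfn_lt => //; polyfun_tac.
have [h1|h1] := dfn_nearly omS (dfn_germ (Q := fun a b => a < b) c hg dlt); first by constructor 1.
have [h2|h2] := dfn_nearly omS (dfn_germ (Q := fun a b => a = b) c hg deq); first by constructor 2.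
have [h3|h3] := dfn_nearly omS (dfn_germ (Q := fun a b => b < a) c hg dgt); first by constructor 3.
(* Otherwise some [x] fails all three alternatives; yet at this fixed [x] the germ in [t] also has a
   constant sign. *)
have [x [[n1 n2] n3]] := nearly_ex (nearly_and (nearly_and h1 h2) h3).
have px : polyfun (T := scal) (fun=> x) by polyfun_tac.
have pt : polyfun (T := scal) (fun t => x + c * t) by polyfun_tac.
have [//|m1] := dfn_nearly omS (dfn_fun1_rel (Q := fun a b => a < b) omS hg px pt dlt).
have [//|m2] := dfn_nearly omS (dfn_fun1_rel (Q := fun a b => a = b) omS hg px pt deq).
exfalso; apply: n3; apply: (nearlyW _ (nearly_and m1 m2)) => t [/negP] + /eqP.
by case: ltgtP.
Qed.

Definition monotone_on (e : R) (g : R -> R) :=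
  (forall a b, 0 < a -> a <= b -> b < e -> g a <= g b) \/
  (forall a b, 0 < a -> a <= b -> b < e -> g b <= g a).

Theorem dfn_monotone (g : R -> R) : dfn_fun1 S g ->
  exists2 e, 0 < e & monotone_on e g.
Proof.
move=> hg.
have E1 (x t : R) : x + 1 * t = x + t by rewrite mul1r.
have E2 (x t : R) : x + -1 * t = x - t by rewrite mulN1r.
have inc : nearly (fun x => nearly (fun t => g (x - t) <= g x)) ->
    nearly (fun x => nearly (fun t => g x <= g (x + t))) ->
    exists2 e, 0 < e & monotone_on e g.
  move=> h1 h2; have [e e0 h] := nearly_and h1 h2.
  by exists e => //; left; apply: locally_nondecreasing.
have dec : nearly (fun x => nearly (fun t => g x <= g (x - t))) ->
    nearly (fun x => nearly (fun t => g (x + t) <= g x)) ->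
    exists2 e, 0 < e & monotone_on e g.
  move=> h1 h2; have [e e0 h] := nearly_and h1 h2.
  exists e => //; right => a b a0 ab be; rewrite -lerN2.
  apply: (@locally_nondecreasing (fun x => - g x) e) => // x /h[k1 k2].
  by split; [apply: nearlyW k1|apply: nearlyW k2] => t; rewrite lerN2.
have W (P Q : R -> R -> Prop) : (forall x t, P x t -> Q x t) ->
    nearly (fun x => nearly (P x)) -> nearly (fun x => nearly (Q x)).
  by move=> PQ; apply: nearlyW => x; apply: nearlyW => t; exact: PQ.
(* Of the nine combinations of left and right signs, seven are locally monotone; in the other two
   every point is a strict local minimum, or every point a strict local maximum, which is
   impossible. *)
case: (dfn_germ_sign (-1) hg) => hl; case: (dfn_germ_sign 1 hg) => hr.
- have [e e0 h] := nearly_and hl hr.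
  exfalso; apply: (@not_all_strict_local_min g e e0) => x /h[k1 k2].
  by split; [apply: nearlyW k1|apply: nearlyW k2] => t; rewrite ?E1 ?E2.
- by apply: dec; [apply: W hl|apply: W hr] => x t; rewrite ?E1 ?E2;
    first [by move=> /ltW|by move=> ->].
- by apply: dec; [apply: W hl|apply: W hr] => x t; rewrite ?E1 ?E2;
    first [by move=> /ltW|by move=> ->].
- by apply: inc; [apply: W hl|apply: W hr] => x t; rewrite ?E1 ?E2;
    first [by move=> /ltW|by move=> ->].
- by apply: inc; [apply: W hl|apply: W hr] => x t; rewrite ?E1 ?E2;
    first [by move=> /ltW|by move=> ->].
- by apply: dec; [apply: W hl|apply: W hr] => x t; rewrite ?E1 ?E2;
    first [by move=> /ltW|by move=> ->].
- by apply: inc; [apply: W hl|apply: W hr] => x t; rewrite ?E1 ?E2;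
    first [by move=> /ltW|by move=> ->].
- by apply: inc; [apply: W hl|apply: W hr] => x t; rewrite ?E1 ?E2;
    first [by move=> /ltW|by move=> ->].
have [e e0 h] := nearly_and hl hr.
exfalso; apply: (@not_all_strict_local_min (fun x => - g x) e e0) => x /h[k1 k2].
by split; [apply: nearlyW k1|apply: nearlyW k2] => t; rewrite ?E1 ?E2 ltrN2.
Qed.

End OMin.
End Monotonicity.

(** * The Euclidean norm and Lipschitz gradients *)

Section Euclidean.
Variables (R : realType) (d : nat).
Implicit Types u v w : 'rV[R]_d.

Definition dotv u v : R := \sum_(j < d) u ord0 j * v ord0 j.

Lemma dotvC u v : dotv u v = dotv v u.
Proof. by apply: eq_bigr => j _; rewrite mulrC. Qed.

Lemma dotvDl u v w : dotv (u + v) w = dotv u w + dotv v w.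
Proof. by rewrite /dotv -big_split /=; apply: eq_bigr => j _; rewrite mxE mulrDl. Qed.

Lemma dotvZl a u v : dotv (a *: u) v = a * dotv u v.
Proof. by rewrite /dotv mulr_sumr; apply: eq_bigr => j _; rewrite mxE mulrA. Qed.

Lemma dotvDr u v w : dotv u (v + w) = dotv u v + dotv u w.
Proof. by rewrite dotvC dotvDl !(dotvC u). Qed.

Lemma dotvZr a u v : dotv u (a *: v) = a * dotv u v.
Proof. by rewrite dotvC dotvZl dotvC. Qed.

Lemma dotvBl u v w : dotv (u - v) w = dotv u w - dotv v w.
Proof. by rewrite dotvDl -scaleN1r dotvZl mulN1r. Qed.

Lemma dotvBr u v w : dotv u (v - w) = dotv u v - dotv u w.
Proof. by rewrite dotvC dotvBl !(dotvC u). Qed.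

Lemma enorm_ge0 v : 0 <= enorm v.
Proof. exact: sqrtr_ge0. Qed.
Hint Resolve enorm_ge0 : core.

Lemma sqr_enorm v : enorm v ^+ 2 = dotv v v.
Proof. by rewrite sqr_sqrtr // sumr_ge0 // => j _; rewrite sqr_ge0. Qed.

Lemma sqr_enorm_sum v : enorm v ^+ 2 = \sum_(j < d) v ord0 j ^+ 2.
Proof. by rewrite sqr_enorm. Qed.

Lemma enorm_le v a : 0 <= a -> dotv v v <= a ^+ 2 -> enorm v <= a.
Proof. by move=> a0; rewrite -sqr_enorm ler_sqr ?nnegrE. Qed.

Lemma enorm0 : enorm (0 : 'rV[R]_d) = 0.
Proof.
by apply/eqP; rewrite -sqrf_eq0 sqr_enorm /dotv big1 // => j _; rewrite mxE mul0r.
Qed.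

Lemma enorm_coord v j : `|v ord0 j| <= enorm v.
Proof.
rewrite -ler_sqr ?nnegrE // sqr_enorm_sum real_normK ?num_real // (bigD1 j) //= lerDl.
by rewrite sumr_ge0 // => i _; rewrite sqr_ge0.
Qed.

Lemma enorm0_eq0 v : enorm v = 0 -> v = 0.
Proof.
move=> v0; apply/rowP => j; rewrite mxE; apply/eqP; rewrite -normr_le0 -v0.
exact: enorm_coord.
Qed.

Lemma enormZ a v : enorm (a *: v) = `|a| * enorm v.
Proof.
apply/eqP; rewrite -(eqrXn2 (n := 2)) ?mulr_ge0 //.
by rewrite exprMn !sqr_enorm dotvZl dotvZr real_normK ?num_real // mulrA.
Qed.

Lemma enormN v : enorm (- v) = enorm v.
Proof. by rewrite -scaleN1r enormZ normrN1 mul1r. Qed.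

Lemma enormB u v : enorm (u - v) = enorm (v - u).
Proof. by rewrite -enormN opprB. Qed.

Lemma dotv_le u v : dotv u v <= enorm u * enorm v.
Proof.
have [u0|u0] := eqVneq (enorm u) 0.
  by rewrite u0 mul0r (enorm0_eq0 u0) /dotv big1 // => j _; rewrite mxE mul0r.
have [v0|v0] := eqVneq (enorm v) 0.
  by rewrite v0 mulr0 (enorm0_eq0 v0) /dotv big1 // => j _; rewrite mxE mulr0.
set a := enorm u; set b := enorm v.
have a0 : 0 < a by rewrite lt_neqAle eq_sym u0 enorm_ge0.
have b0 : 0 < b by rewrite lt_neqAle eq_sym v0 enorm_ge0.
have : 0 <= enorm (b *: u - a *: v) ^+ 2 by rewrite sqr_ge0.
rewrite sqr_enorm dotvBl !dotvBr !dotvZl !dotvZr -!sqr_enorm -/a -/b (dotvC v u) => h.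
have : 0 <= 2 * (a * b) * (a * b - dotv u v) by nra.
by rewrite pmulr_rge0 ?subr_ge0 // !mulr_gt0.
Qed.

Lemma enormD u v : enorm (u + v) <= enorm u + enorm v.
Proof.
apply: enorm_le; first by rewrite addr_ge0.
rewrite dotvDl !dotvDr -!sqr_enorm (dotvC v u); have := dotv_le u v; nra.
Qed.

Lemma enorm_triangle u v w : enorm (u - w) <= enorm (u - v) + enorm (v - w).
Proof. by have := enormD (u - v) (v - w); rewrite addrA subrK. Qed.

Lemma enorm_sum (I : Type) (r : seq I) (P : pred I) (F : I -> 'rV[R]_d) :
  enorm (\sum_(i <- r | P i) F i) <= \sum_(i <- r | P i) enorm (F i).
Proof.
elim/big_ind2: _ => [|x1 x2 y1 y2 h1 h2|//]; first by rewrite enorm0.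
by apply: le_trans (enormD _ _) _; exact: lerD.
Qed.

Lemma enorm_le_sum v : enorm v <= \sum_(j < d) `|v ord0 j|.
Proof.
rewrite {1}(row_sum_delta v); apply: le_trans (enorm_sum _ _ _) _.
apply: ler_sum => j _; rewrite enormZ -[leRHS]mulr1 ler_wpM2l //.
apply: enorm_le => //; rewrite expr1n /dotv (bigD1 j) //= big1 ?addr0 => [|i ij].
  by rewrite !mxE !eqxx mulr1.
by rewrite !mxE (negbTE ij) andbF mulr0.
Qed.

Lemma mxnorm_le_enorm v : `|v| <= enorm v.
Proof.
rewrite /Num.Def.normr /= mx_normrE; apply: bigmax_le => //= -[i j] _ /=.
by rewrite ord1; exact: enorm_coord.
Qed.

Lemma coord_le_mxnorm v j : `|v ord0 j| <= `|v|.
Proof.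
rewrite [leRHS]/Num.Def.normr /= mx_normrE.
by apply/bigmax_geP; right; exists (ord0, j).
Qed.

Lemma enorm_le_mxnorm v : enorm v <= d%:R * `|v|.
Proof.
apply: le_trans (enorm_le_sum v) _.
apply: (@le_trans _ _ (\sum_(j < d) `|v|)).
  by apply: ler_sum => j _; exact: coord_le_mxnorm.
by rewrite sumr_const card_ord mulr_natl.
Qed.

Lemma cvg_enorm (T : Type) (F : set_system T) {FF : Filter F} (f : T -> 'rV[R]_d)
    (l : 'rV[R]_d) :
  f @ F --> l <-> (fun t => enorm (f t - l)) @ F --> (0 : R).
Proof.
rewrite cvgrPdist_lt cvgr0Pnorm_lt; split => h eps e0.
  have d0 : 0 < d%:R + 1 :> R by rewrite ltr_wpDl.
  have := h (eps / (d%:R + 1)); rewrite divr_gt0 // => /(_ isT).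
  apply: filterS => t; rewrite distrC ltr_pdivlMr // => hl.
  rewrite ger0_norm //; apply: le_lt_trans (enorm_le_mxnorm _) _.
  by apply: le_lt_trans hl; rewrite mulrC ler_wpM2l // lerDl.
have := h eps e0; apply: filterS => t; rewrite ger0_norm // distrC.
by apply: le_lt_trans; exact: mxnorm_le_enorm.
Qed.

Variable (f : 'rV[R]_d -> R).
Hypothesis df : forall x, differentiable f x.

Lemma diff_grad x v : 'd f x v = dotv (grad f x) v.
Proof.
rewrite {1}(row_sum_delta v) linear_sum; apply: eq_bigr => j _.
by rewrite linearZ /= mxE mulrC.
Qed.

Lemma mean_value u v :
  exists2 c : R, 0 <= c <= 1 & f v - f u = dotv (grad f (u + c *: (v - u))) (v - u).
Proof.
pose h (t : R) := f (u + t *: (v - u)).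
pose dh (t : R) := dotv (grad f (u + t *: (v - u))) (v - u).
have ih (t : R) : is_derive t (1 : R) h (dh t).
  have E : (fun s : R => s^-1 *: (h (s *: 1 + t) - h t)) =
      (fun s : R => s^-1 *: (f (s *: (v - u) + (u + t *: (v - u))) - f (u + t *: (v - u)))).
    apply/funext => s; congr (_ *: (f _ - _)).
    by rewrite (_ : s *: (1 : R) = s) ?scalerDl 1?addrCA //; exact: mulr1.
  have dv : derivable f (u + t *: (v - u)) (v - u) by exact: diff_derivable.
  apply: DeriveDef.
    by rewrite /derivable E.
  by rewrite /derive E -/(derive _ _ _) deriveE // diff_grad.
have [|c] := @MVT_segment R h dh 0 1 ler01 (fun t _ => ih t).
  apply: derivable_within_continuous => t _; exact: ex_derive.
rewrite in_itv /= => c01; rewrite /h scale1r scale0r addr0 subr0 mulr1 subrKC => ->.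
by exists c.
Qed.

Variable L : R.
Hypothesis L0 : 0 < L.
Hypothesis lipf : forall u v, enorm (grad f u - grad f v) <= L * enorm (u - v).

(** Derived from the mean value theorem rather than by integration, hence the constant L instead of
    L/2. *)
Lemma taylor_bound u v :
  `|f v - f u - dotv (grad f u) (v - u)| <= L * enorm (v - u) ^+ 2.
Proof.
have [c /andP[c0 c1] ->] := mean_value u v.
set w := u + _; rewrite -dotvBl.
have hw : enorm (grad f w - grad f u) <= L * enorm (v - u).
  apply: le_trans (lipf _ _) _; rewrite ler_pM2l // /w [u + _]addrC addrK enormZ ger0_norm //.
  by rewrite ler_piMl.
have D (x y : 'rV[R]_d) : `|dotv x y| <= enorm x * enorm y.
  rewrite ler_norml dotv_le andbT lerNl -mulN1r -dotvZl scaleN1r.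
  by apply: le_trans (dotv_le _ _) _; rewrite enormN.
apply: le_trans (D _ _) _; rewrite expr2 mulrA; exact: ler_wpM2r.
Qed.

(** The derivative-free description that makes the gradient norm definable. The quadratic term does
    no harm in the converse, where it is tested on a short step along the gradient. *)
Lemma grad_norm_le x (s : R) : 0 <= s ->
  enorm (grad f x) <= s <->
  (forall y, f y - f x <= s * enorm (y - x) + L * enorm (y - x) ^+ 2).
Proof.
move=> s0; split => [gs y|h].
  have := taylor_bound x y; rewrite ler_norml => /andP[_].
  have := dotv_le (grad f x) (y - x).
  have := ler_wpM2r (enorm_ge0 (y - x)) gs; lra.
rewrite leNgt; apply/negP; set g := enorm _ => sg.
have g0 : 0 < g by lra.
(* Chosen so that 2 L t g = (g - s) / 2; after division by t g the tested inequality reads (g - s) /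
   2 <= 0. *)
pose t := (g - s) / (4 * L * g).
have Lg : 0 < 4 * L * g by rewrite !mulr_gt0.
have t0 : 0 < t by rewrite divr_gt0 // subr_gt0.
have tE : t * (4 * L * g) = g - s by rewrite divfK // gt_eqF.
have := h (x + t *: grad f x); have := taylor_bound x (x + t *: grad f x).
rewrite [x + _]addrC addrK enormZ (gtr0_norm t0) -/g ler_norml dotvZr -sqr_enorm -/g.
move=> /andP[h1 _] h2.
have h3 : t * g ^+ 2 - L * (t * g) ^+ 2 <= s * (t * g) + L * (t * g) ^+ 2 by lra.
have tg : 0 < t * g by rewrite mulr_gt0.
have : (t * g) * (g - s - 2 * L * (t * g)) <= 0 by move: h3; lra.
rewrite (pmulr_rle0 _ tg) (_ : 2 * L * (t * g) = (g - s) / 2); first lra.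
by rewrite -tE; field.
Qed.

(* A gradient step of length 1/(2L) stays above the lower bound. *)
Lemma sqr_grad_le (fb : R) x : (forall v, fb <= f v) ->
  enorm (grad f x) ^+ 2 <= 4 * L * (f x - fb).
Proof.
move=> hb; pose t : R := (2 * L)^-1.
have L2 : 0 < 2 * L by rewrite mulr_gt0.
have t0 : 0 < t by rewrite invr_gt0.
have := taylor_bound x (x - t *: grad f x); have := hb (x - t *: grad f x).
rewrite [x - _]addrC addrK enormN enormZ (gtr0_norm t0) -scaleNr dotvZr -sqr_enorm.
rewrite ler_norml => h1 /andP[_]; set g := enorm _ => h2.
have tE : t * (2 * L) = 1 by rewrite mulVf // gt_eqF.
have : L * (t * g) ^+ 2 = t * g ^+ 2 / 2.
  by transitivity (t * (2 * L) * (t * g ^+ 2 / 2)); [field|rewrite tE mul1r].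
move=> h3; have : t * g ^+ 2 / 2 <= f x - fb by move: h2; rewrite h3; lra.
rewrite -(ler_pM2l (x := 4 * L)) ?mulr_gt0 //; have -> : 4 * L * (t * g ^+ 2 / 2) = g ^+ 2.
  by transitivity (t * (2 * L) * g ^+ 2); [field|rewrite tE mul1r].
by [].
Qed.

End Euclidean.
#[export] Hint Resolve enorm_ge0 : core.

Lemma lip_continuous (R : realType) d (K : R) (g : 'rV[R]_d -> R) :
  (forall x y, `|g x - g y| <= K * enorm (x - y)) -> continuous g.
Proof.
move=> hg x; apply/(@cvgrPdist_lt _ _ _ (nbhs x) (nbhs_filter x)) => eps e0.
have K0 : 0 < `|K| + 1 by rewrite ltr_wpDl.
have /(@cvgr0Pnorm_lt _ _ _ (nbhs x) (nbhs_filter x)) :=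
  (@cvg_enorm _ _ _ (nbhs x) (nbhs_filter x) (fun y : 'rV[R]_d => y) x).1 (@cvg_id _ _).
move/(_ (eps / (`|K| + 1))); rewrite divr_gt0 // => /(_ isT).
apply: filterS => y; rewrite ger0_norm ?enorm_ge0 // ltr_pdivlMr // => h.
apply: le_lt_trans (hg _ _) _; rewrite enormB; apply: le_lt_trans h.
rewrite mulrC ler_wpM2l ?enorm_ge0 //; have := ler_norm K; lra.
Qed.

Lemma enorm_dist (R : realType) d (u v : 'rV[R]_d) : `|enorm u - enorm v| <= enorm (u - v).
Proof.
have := enormD (u - v) v; rewrite subrK; have := enormD (v - u) u; rewrite subrK enormB.
by rewrite ler_norml; lra.
Qed.

Lemma enorm_continuous (R : realType) d : continuous (@enorm R d).
Proof. by apply: (@lip_continuous _ _ 1) => x y; rewrite mul1r; exact: enorm_dist. Qed.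

(* A jump of v forces only a slope h/eta on a cell of length h, which vanishes
   when the mesh is refined faster than eta: v need not be continuous. *)
Lemma subdivision_bound (R : realType) (v : R -> R) (M L s t : R) :
  s <= t -> 0 <= L -> 0 <= M ->
  (forall a b, s <= a -> a <= b -> b <= t -> v a <= v b) ->
  (forall a b, s <= a -> a <= b -> b <= t ->
     b - a <= M * (v b - v a) + L * (v b - v a) ^+ 2) ->
  t - s <= M * (v t - v s).
Proof.
move=> st L0 M0 vmono hv.
have V0 : 0 <= v t - v s by rewrite subr_ge0; apply: vmono.
have step (N : nat) : t - s <= (M + (L + (t - s)) / N.+1%:R) * (v t - v s).
  have N0 : 0 < N.+1%:R :> R by rewrite ltr0n.
  (* With n = N + 1, the mesh (t - s)/n^2 is set against the threshold 1/n for the increment [D] of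
     [v]. Below it, L D^2 <= (L/n) D; above it, h <= h n D = ((t - s)/n) D. Both cases fit the slope
     [K]. *)
  pose h : R := (t - s) / (N.+1 * N.+1)%:R.
  have h0 : 0 <= h by rewrite divr_ge0 // subr_ge0.
  have hE : h * (N.+1 * N.+1)%:R = t - s by rewrite divfK // pnatr_eq0.
  pose T (i : nat) : R := s + i%:R * h.
  have Tt i : (i <= N.+1 * N.+1)%N -> s <= T i /\ T i <= t.
    move=> iN; rewrite /T lerDl mulr_ge0 //; split => //.
    by rewrite -lerBrDl -hE mulrC ler_wpM2l // ler_nat.
  set K := M + _.
  have K0 : 0 <= K.
    by apply: addr_ge0 => //; apply: divr_ge0 => //; apply: addr_ge0 => //; rewrite subr_ge0.
  have cell i : (i < N.+1 * N.+1)%N -> h <= K * (v (T i.+1) - v (T i)).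
    move=> iN; have [sT _] := Tt i (ltnW iN); have [_ Tt'] := Tt i.+1 iN.
    have TS : T i.+1 - T i = h by rewrite /T -natr1; ring.
    have TT : T i <= T i.+1 by rewrite -subr_ge0 TS.
    have := hv _ _ sT TT Tt'; have := vmono _ _ sT TT Tt'; rewrite TS -subr_ge0.
    set D := v _ - v _ => D0 hD.
    have KE : K = M + L * N.+1%:R^-1 + h * N.+1%:R.
      by rewrite /K /h natrM; move: (lt0r_neq0 N0); move: (N.+1%:R : R) => n n0; field.
    have i0 : 0 < N.+1%:R^-1 :> R by rewrite invr_gt0.
    move: KE i0 N0; set iv : R := N.+1%:R^-1; set n : R := N.+1%:R => KE i0 N0.
    have nE : n * iv = 1 by rewrite mulfV // gt_eqF.
    clearbody iv n K.
    have [Dn|nD] := leP D iv.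
      apply: le_trans hD _; rewrite KE.
      have := ler_wpM2l (mulr_ge0 L0 D0) Dn.
      have : 0 <= h * n * D by apply: mulr_ge0 => //; apply: mulr_ge0 => //; exact: ltW.
      by lra.
    rewrite KE.
    have : h * 1 <= h * (n * D).
      by rewrite ler_wpM2l // -nE ler_pM2l // ltW.
    have : 0 <= M * D by rewrite mulr_ge0.
    have : 0 <= L * iv * D by apply: mulr_ge0 => //; apply: mulr_ge0 => //; exact: ltW.
    by lra.
  have sumE k : (k <= N.+1 * N.+1)%N -> k%:R * h <= K * (v (T k) - v s).
    elim: k => [|k IH] kN.
      by rewrite mul0r /T mul0r addr0 subrr mulr0.
    have := IH (ltnW kN); have := cell k kN; rewrite -natr1; lra.
  have := sumE _ (leqnn _); rewrite mulrC hE /T (mulrC _ h) hE.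
  by rewrite [s + _]addrC subrK.
rewrite leNgt; apply/negP => lt.
set V := v t - v s in V0 step lt.
have C0 : 0 <= (L + (t - s)) * V by rewrite mulr_ge0 // addr_ge0 // subr_ge0.
have g0 : 0 < t - s - M * V by rewrite subr_gt0.
have D0 : 0 < (L + (t - s)) * V + 1 by rewrite ltr_wpDl.
have q0 : 0 < (t - s - M * V) / ((L + (t - s)) * V + 1) by rewrite divr_gt0.
have [N] := ltr_add_invr q0; rewrite add0r ltr_pdivlMr //.
have := step N; have : 0 < N.+1%:R^-1 :> R by rewrite invr_gt0.
move: (N.+1%:R^-1 : R) => iv; lra.
Qed.

(** * The Kurdyka-Lojasiewicz inequality *)

Section Lex.
Variables (R : realType) (d : nat).
Implicit Types (X : set 'rV[R]_d) (x y : 'rV[R]_d).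

Definition lexmin X x := X x /\ forall y, X y -> forall i : 'I_d,
  (forall j : 'I_d, (j < i)%N -> x ord0 j = y ord0 j) -> x ord0 i <= y ord0 i.

Lemma lexmin_unique X x y : lexmin X x -> lexmin X y -> x = y.
Proof.
move=> [Xx hx] [Xy hy].
have H k : forall i : 'I_d, (i < k)%N -> x ord0 i = y ord0 i.
  elim: k => // k IH i; rewrite ltnS => ik; apply/eqP; rewrite eq_le.
  apply/andP; split; [apply: hx => //|apply: hy => //] => j ji.
    by apply: IH; exact: leq_trans ji ik.
  by rewrite IH //; exact: leq_trans ji ik.
by apply/rowP => i; apply: (H d).
Qed.

Lemma closed_coord_eq j (a : R) : closed [set y : 'rV[R]_d | y ord0 j = a].
Proof.
apply: (@preimage_closed _ _ (fun y : 'rV[R]_d => y ord0 j) [set a]) => //.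
  by move=> y _; exact: coord_continuous.
Qed.

(** The coordinates are minimised one after the other; agreeing with the current choice on the first
    [k] of them is a closed condition, so compactness persists. *)
Lemma lexmin_exists X : compact X -> X !=set0 -> exists x, lexmin X x.
Proof.
move=> cX [x0 Xx0].
suff H k : exists x, X x /\ forall y, X y -> forall i : 'I_d, (i < k)%N ->
    (forall j : 'I_d, (j < i)%N -> x ord0 j = y ord0 j) -> x ord0 i <= y ord0 i.
  by have [x [Xx hx]] := H d; exists x; split => // y Xy i; apply: hx.
elim: k => [|k [x [Xx hx]]]; first by exists x0.
have [kd|dk] := ltnP k d; last first.
  by exists x; split => // y Xy i _; apply: hx => //; exact: leq_trans dk.
pose K := \bigcap_(j in [set j : 'I_d | (j < k)%N]) [set y : 'rV[R]_d | y ord0 j = x ord0 j].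
have cK : closed K by apply: closed_bigI => j _; exact: closed_coord_eq.
have [||z] := @compact_EVT_min _ R (fun y : 'rV[R]_d => y ord0 (Ordinal kd)) (X `&` K) _
  (compact_closedI cX cK).
- by exists x; split.
- by apply: continuous_subspaceT => y; exact: coord_continuous.
rewrite inE => -[Xz Kz] hz; exists z; split => // y Xy i.
rewrite ltnS leq_eqVlt => /predU1P[ik|ik] hj.
  have -> : i = Ordinal kd by exact: val_inj.
  apply: hz; rewrite inE; split => // j jk /=; rewrite -hj ?ik //.
  exact: Kz.
rewrite (Kz i ik); apply: hx => // j ji; rewrite -hj // (Kz j) //.
exact: ltn_trans ji ik.
Qed.
End Lex.

(** * The talweg: a definable curve of flattest points on the levels *)

Section Talweg.
Variables (R : realType) (d : nat) (S : forall n : nat, set (set 'rV[R]_n)).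
Hypothesis omS : ominimal S.
Variables (f G : 'rV[R]_d -> R) (L rho c : R).
(* G is the norm of the gradient of f; this first-order description of it is
   what makes it definable. *)
Hypothesis G_ge0 : forall x, 0 <= G x.
Hypothesis G_le : forall x s, 0 <= s -> G x <= s <->
  (forall y, f y - f x <= s * enorm (y - x) + L * enorm (y - x) ^+ 2).
Hypothesis deff : dfn_fun S f.
Hypothesis rho0 : 0 <= rho.

Notation dfn := (dfn S).
Notation scal := (ctx_scal R).
Notation vec := (ctx_vec R d).

Definition level (t : R) (x : 'rV[R]_d) := enorm x <= rho /\ f x = c + t.
Definition flattest (t : R) (x : 'rV[R]_d) :=
  level t x /\ forall y, level t y -> G x <= G y.
(* Selecting the lexicographic minimum replaces definable choice. *)
Definition talweg (t : R) : 'rV[R]_d := xget 0 (lexmin (flattest t)).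

Lemma dfn_level : dfn (fun p : ctx_prod vec scal => level p.2 p.1).
Proof.
apply: dfn_and => //.
  apply: (dfn_ext (P := fun p : ctx_prod vec scal => \sum_(j < d) p.1 ord0 j ^+ 2 <= rho ^+ 2)).
    by move=> [x t] /=; rewrite -sqr_enorm_sum ler_sqr ?nnegrE ?enorm_ge0.
  by apply: dfn_le => //; polyfun_tac.
apply: (dfn_subst2 (P := fun x a => f x = a) omS deff); first by polyfun_tac.
by apply: polymap_scal; polyfun_tac.
Qed.

(** The sign of [s] is built in because [G_le] describes the second condition only for nonnegative
    [s]. *)
Definition gle (x : 'rV[R]_d) (s : R) := 0 <= s /\ G x <= s.

Lemma dfn_gle : dfn (fun p : ctx_prod vec scal => gle p.1 p.2).
Proof.
(* The distance and the two values of [f] become variables [r], [a], [b]; [r] is pinned down by its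
   sign and its square. *)
apply: (dfn_ext (P := fun p : ctx_prod vec scal => 0 <= p.2 /\
   forall y : vec, forall r a b : R,
   (0 <= r /\ r ^+ 2 = \sum_(j < d) (y ord0 j - p.1 ord0 j) ^+ 2) /\ (f y = a /\ f p.1 = b) ->
   a - b <= p.2 * r + L * r ^+ 2)).
  move=> [x s] /=; split => -[s0 h]; split => //.
    apply/(G_le x s0) => y.
    apply: (h y _ (f y) (f x)); do 2 split => //.
    by rewrite sqr_enorm_sum; apply: eq_bigr => j _; rewrite !mxE.
  move=> y r a b [[r0 rE] [<- <-]].
  have -> : r = enorm (y - x).
    apply/eqP; rewrite -(eqrXn2 (n := 2)) ?enorm_ge0 // rE sqr_enorm_sum; apply/eqP.
    by apply: eq_bigr => j _; rewrite !mxE.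
  exact: (G_le x s0).1.
apply: dfn_and => //; first by apply: dfn_le => //; polyfun_tac.
apply: dfn_allV => //; do 3 apply: dfn_all => //; apply: dfn_imp => //; last first.
  by apply: dfn_le => //; polyfun_tac.
apply: dfn_and => //; apply: dfn_and => //.
- by apply: dfn_le => //; polyfun_tac.
- by apply: dfn_eq => //; polyfun_tac.
- apply: (dfn_subst2 (P := fun x a => f x = a) omS deff); first by polyfun_tac.
  by apply: polymap_scal; polyfun_tac.
- apply: (dfn_subst2 (P := fun x a => f x = a) omS deff); first by polyfun_tac.
  by apply: polymap_scal; polyfun_tac.
Qed.

Lemma dfn_flattest : dfn (fun p : ctx_prod vec scal => flattest p.2 p.1).
Proof.
apply: dfn_and => //; first exact: dfn_level.
(* [G] is not a polynomial term, so a comparison of two of its values is read as an inclusion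
   between their sets of upper bounds. *)
apply: (dfn_ext (P := fun p : ctx_prod vec scal => forall y : vec, level p.2 y ->
    forall s, gle y s -> gle p.1 s)).
  move=> [x t]; split => /= h y ly.
    by have [] := h y ly (G y) (conj (G_ge0 _) (lexx _)).
  by move=> s [s0 ys]; split => //; apply: le_trans ys; exact: h.
apply: dfn_allV => //; apply: dfn_imp => //.
  apply: (dfn_subst2 (P := fun x t => level t x) omS dfn_level); first by polyfun_tac.
  by apply: polymap_scal; polyfun_tac.
apply: dfn_all => //; apply: dfn_imp => //.
  apply: (dfn_subst2 (P := gle) omS dfn_gle); first by polyfun_tac.
  by apply: polymap_scal; polyfun_tac.
apply: (dfn_subst2 (P := gle) omS dfn_gle); first by polyfun_tac.
by apply: polymap_scal; polyfun_tac.
Qed.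

Lemma dfn_lexmin : dfn (fun p : ctx_prod vec scal => lexmin (flattest p.2) p.1).
Proof.
apply: dfn_and => //; first exact: dfn_flattest.
apply: dfn_allV => //; apply: dfn_imp => //.
  apply: (dfn_subst2 (P := fun x t => flattest t x) omS dfn_flattest); first by polyfun_tac.
  by apply: polymap_scal; polyfun_tac.
apply: dfn_forall_ord => // i; apply: dfn_imp => //; last by apply: dfn_le => //; polyfun_tac.
apply: dfn_forall_ord => // j; apply: dfn_imp => //; first exact: dfn_cst.
by apply: dfn_eq => //; polyfun_tac.
Qed.

(** Spells out [xget] together with its default 0, since definability of the curve has to account
    for every [t], including those without a lexicographic minimum. *)
Lemma talwegE t x : talweg t = x <->
  lexmin (flattest t) x \/ (~ (exists y, lexmin (flattest t) y) /\ forall j, x ord0 j = 0).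
Proof.
rewrite /talweg; case: xgetP => [y yE hy|hn].
  split => [<-|[hx|[[]]]]; [by left|exact: (lexmin_unique hy hx)|by exists y].
split => [<-|[hx|[_ x0]]]; last by apply/rowP => j; rewrite mxE x0.
  by right; split => [[y /hn]//|j]; rewrite mxE.
by have := hn x.
Qed.

Lemma dfn_talweg : dfn (fun p : ctx_prod scal vec => talweg p.1 = p.2).
Proof.
apply: (dfn_ext (fun p => iff_sym (talwegE p.1 p.2))).
apply: dfn_or => //; last apply: dfn_and => //.
- apply: (dfn_subst2 (P := fun x t => lexmin (flattest t) x) omS dfn_lexmin); first by polyfun_tac.
  by apply: polymap_scal; polyfun_tac.
- apply: dfn_not => //; apply: dfn_exV => //.
  apply: (dfn_subst2 (P := fun x t => lexmin (flattest t) x) omS dfn_lexmin); first by polyfun_tac.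
  by apply: polymap_scal; polyfun_tac.
- by apply: dfn_forall_ord => // j; apply: dfn_eq => //; polyfun_tac.
Qed.

Lemma dfn_talweg_coord i : dfn_fun1 S (fun t => talweg t ord0 i).
Proof.
apply: (dfn_ext (P := fun p : ctx_prod scal scal =>
    exists x : vec, talweg p.1 = x /\ x ord0 i = p.2)).
  by move=> p; split => [[x [-> //]]|h]; exists (talweg p.1).
apply: dfn_exV => //; apply: dfn_and => //; last by apply: dfn_eq => //; polyfun_tac.
apply: (dfn_subst2 (P := fun t x => talweg t = x) omS dfn_talweg); last by polyfun_tac.
by apply: polymap_scal; polyfun_tac.
Qed.

Lemma dfn_talweg_grad : dfn_fun1 S (fun t => G (talweg t)).
Proof.
apply: (dfn_ext (P := fun p : ctx_prod scal scal => exists x : vec, talweg p.1 = x /\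
   (gle x p.2 /\ forall s, gle x s -> p.2 <= s))).
  move=> [t a]; split => /= [[x [-> [[a0 xa] h]]]|<-].
    by apply/le_anti; rewrite xa h //; split.
  by exists (talweg t); do !split => //; move=> s [].
apply: dfn_exV => //; apply: dfn_and => //; last apply: dfn_and => //.
- apply: (dfn_subst2 (P := fun t x => talweg t = x) omS dfn_talweg); last by polyfun_tac.
  by apply: polymap_scal; polyfun_tac.
- apply: (dfn_subst2 (P := gle) omS dfn_gle); first by polyfun_tac.
  by apply: polymap_scal; polyfun_tac.
- apply: dfn_all => //; apply: dfn_imp => //; last by apply: dfn_le => //; polyfun_tac.
  apply: (dfn_subst2 (P := gle) omS dfn_gle); first by polyfun_tac.
  by apply: polymap_scal; polyfun_tac.
Qed.

Hypothesis cf : continuous f.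
Hypothesis cG : continuous G.

Lemma compact_level t : compact (level t).
Proof.
apply: bounded_closed_compact.
  exists rho; split; first exact: num_real.
  move=> M rM x [xr _]; apply: le_trans (ltW rM); apply: le_trans xr.
  exact: mxnorm_le_enorm.
apply: closedI.
  apply: (@preimage_closed _ _ (@enorm R d) [set r | r <= rho]); last exact: closed_le.
  move=> x _; exact: enorm_continuous.
apply: (@preimage_closed _ _ f [set c + t]) => // x _; exact: cf.
Qed.

Lemma lexmin_talweg t : (exists x, level t x) -> lexmin (flattest t) (talweg t).
Proof.
move=> lt; have [|x] := @compact_EVT_min _ R G (level t) lt (compact_level (t := t)).
  by apply: continuous_subspaceT => y; exact: cG.
rewrite inE => lx hx.
have [||z] := @lexmin_exists R d (flattest t).
- have -> : flattest t = level t `&` [set y | G y <= G x].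
    apply/seteqP; split => y [ly hy]; split => //.
      exact: hy.
    by move=> w lw; apply: le_trans hy _; apply: hx; rewrite inE.
  apply: compact_closedI; first exact: compact_level.
  apply: (@preimage_closed _ _ G [set r | r <= G x]); last exact: closed_le.
  by move=> y _; exact: cG.
- by exists x; split => // y ly; apply: hx; rewrite inE.
- by rewrite /talweg => hz; case: xgetP => // /(_ z).
Qed.

Lemma dfn_level_ex : dfn (T := scal) (fun t => exists x, level t x).
Proof.
apply: dfn_exV => //; apply: (dfn_subst2 (P := fun x t => level t x) omS dfn_level).
  by polyfun_tac.
by apply: polymap_scal; polyfun_tac.
Qed.

End Talweg.

Section Desingularization.
Variable R : realType.

(* W stands for 1/phi': the fourth condition is phi' >= 1/W integrated over
   [s, r] for a nondecreasing W, and makes sense without differentiability. *)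
Definition desing (e : R) (W phi : R -> R) :=
  [/\ 0 < e, forall r, 0 < r < e -> 0 < W r,
      forall a b, 0 < a -> a <= b -> b < e -> W a <= W b,
      forall s r, 0 < s -> s < r -> r < e -> r - s <= W r * (phi r - phi s) &
      exists B, forall r, 0 < r < e -> `|phi r| <= B].

(** Serves the degenerate cases: no level just above [c] meets the ball, or the gradient norm is
    bounded away from 0 there. *)
Lemma desing_const e w : 0 < e -> 0 < w -> desing e (fun=> w) (fun r => r / w).
Proof.
move=> e0 w0; split => //.
- by move=> s r _ _ _; rewrite -mulrBl mulrC divfK // gt_eqF.
- exists (e / w) => r re; rewrite ger0_norm ?ler_pM2r ?invr_gt0 //; first lra.
  by apply: divr_ge0; lra.
Qed.

End Desingularization.

Section KL.
Variables (R : realType) (d : nat) (S : forall n : nat, set (set 'rV[R]_n)).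
Hypothesis omS : ominimal S.
Variables (f G : 'rV[R]_d -> R) (L rho c : R).
Hypothesis L0 : 0 < L.
Hypothesis G_ge0 : forall x, 0 <= G x.
Hypothesis G_le : forall x s, 0 <= s -> G x <= s <->
  (forall y, f y - f x <= s * enorm (y - x) + L * enorm (y - x) ^+ 2).
Hypothesis cf : continuous f.
Hypothesis cG : continuous G.
Hypothesis deff : dfn_fun S f.
Hypothesis rho0 : 0 <= rho.

Lemma KL_above : exists e W phi, desing e W phi /\
  forall x, enorm x <= rho -> 0 < f x - c < e -> W (f x - c) <= G x.
Proof.
have dl := dfn_level_ex omS c deff rho0.
(* Levels just above [c] either all meet the ball or all miss it; in the second case the claim is
   vacuous. *)
have [[e0 e00 hl]|[e0 e00 hl]] := dfn_nearly omS dl; last first.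
  exists e0, (fun=> 1), (fun r => r / 1); split; first exact: desing_const.
  by move=> x xr xe; exfalso; apply: (hl _ xe); exists x; split => //; rewrite subrKC.
pose g := talweg f G rho c.
have nmon h : dfn_fun1 S h -> nearly (fun e => monotone_on e h).
  move=> /(dfn_monotone omS)[e1 e10 hm]; exists e1 => // e2 /andP[_ e21].
  by case: hm => hm; [left|right] => a b a0 ab be; apply: hm => //; exact: lt_trans e21.
have n1 : nearly (fun e => forall t, 0 < t < e -> exists x, level f rho c t x).
  by exists e0 => // e1 /andP[_ e10] t /andP[t0 te]; apply: hl; rewrite t0 (lt_trans te).
have n2 := nearly_forall_ord (fun i => nmon _ (dfn_talweg_coord omS c G_ge0 G_le deff rho0 i)).
have n3 := nmon _ (dfn_talweg_grad omS c G_ge0 G_le deff rho0).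
have n4 : nearly (fun e : R => 0 < e) by exists 1 => // t /andP[].
have [e [e_gt0 [hlev [hg hm]]]] := nearly_ex (nearly_and n4 (nearly_and n1 (nearly_and n2 n3))).
rewrite -/g in hg hm; move: {n1 n2 n3 n4 e0 e00 hl nmon} hlev hg hm => hlev hg hm.
have gP t : 0 < t < e -> level f rho c t (g t) /\
    forall x, level f rho c t x -> G (g t) <= G x.
  by move=> te; have [] := lexmin_talweg cf cG (hlev t te).
(* The signs turn every coordinate of [g] into a nondecreasing function, so an increment of [v] is
   the l1 distance of two points of the curve, which dominates the Euclidean one. *)
pose sg i : R := if pselect (forall a b, 0 < a -> a <= b -> b < e -> g a ord0 i <= g b ord0 i)
  then 1 else -1.
pose v t := \sum_i sg i * g t ord0 i.
have vB a b : 0 < a -> a <= b -> b < e -> v b - v a = \sum_i `|(g b - g a) ord0 i|.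
  move=> a0 ab be; rewrite /v -sumrB; apply: eq_bigr => i _; rewrite !mxE -mulrBr /sg.
  case: pselect => [h|h]; first by rewrite mul1r ger0_norm // subr_ge0 h.
  by case: (hg i) => // h'; rewrite mulN1r ler0_norm // subr_le0 h'.
have vmono a b : 0 < a -> a <= b -> b < e -> v a <= v b.
  by move=> a0 ab be; rewrite -subr_ge0 vB // sumr_ge0.
have dist a b : 0 < a -> a <= b -> b < e -> enorm (g b - g a) <= v b - v a.
  by move=> a0 ab be; rewrite vB //; exact: enorm_le_sum.
(* [G_le] between two points of the curve bounds the difference of levels; replacing the distance by
   the increment of [v] gives the hypothesis of [subdivision_bound]. *)
have speed s t M : 0 < s -> s <= t -> t < e -> 0 <= M ->
    (forall u, s <= u <= t -> G (g u) <= M) -> t - s <= M * (v t - v s).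
  move=> s0 st te M0 hM; apply: (@subdivision_bound _ v M L s t st (ltW L0) M0).
    by move=> a b sa ab bt; apply: vmono => //; lra.
  move=> a b sa ab bt.
  have [[_ fa] _] := gP a ltac:(lra); have [[_ fb] _] := gP b ltac:(lra).
  have := (G_le (g a) (G_ge0 _)).1 (lexx _) (g b); rewrite fa fb.
  have := dist a b ltac:(lra) ab ltac:(lra).
  have := enorm_ge0 (g b - g a); have := hM a ltac:(lra); have := G_ge0 (g a).
  set D := v b - v a; set x := enorm _; set y := G _ => y0 yM x0 xD.
  have h1 : y * x <= M * D by apply: ler_pM.
  have h2 : L * x ^+ 2 <= L * D ^+ 2 by rewrite ler_pM2l // ler_sqr ?nnegrE //; lra.
  lra.
have vbd t : 0 < t < e -> `|v t| <= d%:R * rho.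
  move=> te; apply: le_trans (ler_norm_sum _ _ _) _.
  apply: (@le_trans _ _ (\sum_(i < d) rho)); last by rewrite sumr_const card_ord mulr_natl.
  apply: ler_sum => i _; rewrite normrM (_ : `|sg i| = 1) ?mul1r.
    by apply: le_trans (enorm_coord _ _) _; have [[]] := gP t te.
  by rewrite /sg; case: pselect => ? /=; rewrite ?normrN1 ?normr1.
have low x : enorm x <= rho -> 0 < f x - c < e -> G (g (f x - c)) <= G x.
  by move=> xr xe; have [_] := gP _ xe; apply; split => //; rewrite subrKC.
case: hm => hm.
- exists e, (fun t => G (g t)), v; split => //.
  have key s r : 0 < s -> s < r -> r < e -> r - s <= G (g r) * (v r - v s).
    move=> s0 sr re; apply: speed => //; first exact: ltW.
    by move=> u /andP[su ur]; apply: hm => //; lra.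
  split => //; last by exists (d%:R * rho).
  (* A zero of the least gradient norm at [r] would be a zero slope on [r/2, r], forcing r/2 <=
     0. *)
  move=> r re; rewrite lt_neqAle G_ge0 andbT eq_sym; apply/negP => /eqP r0.
  by have := key (r / 2) r; rewrite r0 mul0r => /(_ ltac:(lra) ltac:(lra) ltac:(lra)); lra.
(* If the least gradient norm is nonincreasing, its value at e/2 bounds it from below near 0+ and a
   constant [W] suffices. This value is positive, as otherwise the slope would vanish on
   [e/2, 3e/4]. *)
- pose t0 := e / 2; have t00 : 0 < t0 by rewrite /t0; lra.
  have m0 : 0 < G (g t0).
    rewrite lt_neqAle G_ge0 andbT eq_sym; apply/negP => /eqP r0.
    have := speed t0 (e / 4 * 3) 0 t00; rewrite mul0r /t0 => H.
    suff : e / 4 * 3 - e / 2 <= 0 by lra.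
    apply: H => //; [lra|lra|] => u /andP[u1 u2]; rewrite -r0; apply: hm => //; lra.
  exists t0, (fun=> G (g t0)), (fun r => r / G (g t0)); split; first exact: desing_const.
  move=> x xr xe; apply: le_trans (low x xr _); last by move: xe; rewrite /t0; lra.
  by apply: hm; move: xe; rewrite /t0; lra.
Qed.

End KL.

Section DesingOps.
Variable R : realType.
Implicit Types (e : R) (W phi : R -> R).

Lemma desing_lt e W phi s r : desing e W phi -> 0 < s -> s < r -> r < e -> phi s < phi r.
Proof.
move=> [_ W0 _ key _] s0 sr re; have := key s r s0 sr re.
have w0 := W0 r ltac:(lra); rewrite -subr_gt0 -(pmulr_rgt0 _ w0) => h.
by apply: lt_le_trans h; rewrite subr_gt0.
Qed.

Lemma desing_le e W phi s r : desing e W phi -> 0 < s -> s <= r -> r < e -> phi s <= phi r.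
Proof.
move=> D s0; rewrite le_eqVlt => /predU1P[->//|sr] re; exact/ltW/(desing_lt D).
Qed.

(** Whichever [W] is smaller, the increment of its own [phi] is at most the increment of the sum,
    because both are increasing. *)
Lemma desing_min e1 W1 phi1 e2 W2 phi2 :
  desing e1 W1 phi1 -> desing e2 W2 phi2 ->
  desing (Num.min e1 e2) (fun r => Num.min (W1 r) (W2 r)) (fun r => phi1 r + phi2 r).
Proof.
move=> D1 D2; have [e10 W10 m1 k1 [B1 b1]] := D1; have [e20 W20 m2 k2 [B2 b2]] := D2.
split.
- by rewrite lt_min e10.
- by move=> r; rewrite !lt_min => /and3P[r0 r1 r2]; rewrite W10 ?W20 ?r0.
- move=> a b a0 ab; rewrite lt_min => /andP[be1 be2].
  by rewrite le_min !ge_min m1 // m2 // orbT.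
- move=> s r s0 sr; rewrite lt_min => /andP[re1 re2].
  have := desing_lt D1 s0 sr re1; have := desing_lt D2 s0 sr re2 => h2 h1.
  have w1 := W10 r ltac:(lra); have w2 := W20 r ltac:(lra).
  have [->|->] : Num.min (W1 r) (W2 r) = W1 r \/ Num.min (W1 r) (W2 r) = W2 r.
  - by case: (leP (W1 r) (W2 r)) => _; [left|right].
  - apply: le_trans (k1 s r s0 sr re1) _; rewrite ler_pM2l //; lra.
  - apply: le_trans (k2 s r s0 sr re2) _; rewrite ler_pM2l //; lra.
- exists (B1 + B2) => r; rewrite lt_min => /and3P[r0 r1 r2].
  by apply: le_trans (ler_normD _ _) _; apply: lerD; [apply: b1|apply: b2]; rewrite r0.
Qed.

Lemma desing_half e W phi : desing e W phi ->
  desing e (fun r => W (r / 2)) (fun r => 2 * phi (r / 2)).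
Proof.
move=> [e0 W0 mW key [B hB]]; split => //.
- by move=> r re; apply: W0; lra.
- by move=> a b a0 ab be; apply: mW; lra.
- move=> s r s0 sr re; have := key (s / 2) (r / 2) ltac:(lra) ltac:(lra) ltac:(lra); lra.
- exists (2 * B) => r re; rewrite normrM ger0_norm // ler_pM2l //; apply: hB; lra.
Qed.

(** The derivative of [phi] is exactly 1/W, and xi < 1 keeps [phi] bounded at 0. The inequality
    amounts to x^(1-xi) <= (1-xi) x + xi at x = s/r, which is Young's inequality with second factor
    1. *)
Lemma desing_pow (xi : R) : 0 < xi < 1 ->
  desing 1 (fun r => r `^ xi) (fun r => r `^ (1 - xi) / (1 - xi)).
Proof.
move=> /andP[x0 x1]; have y0 : 0 < 1 - xi by lra.
split => //.
- by move=> r /andP[r0 _]; rewrite powR_gt0.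
- by move=> a b a0 ab _; rewrite ge0_ler_powR ?nnegrE //; lra.
- move=> s r s0 sr _; have r0 : 0 < r by lra.
  rewrite -mulrBl mulrA ler_pdivlMr // [leRHS]mulrBr -powRD ?(gt_eqF r0) ?implybT //.
  rewrite subrKC powRr1 ?(ltW r0) //.
  have q0 : 0 < s / r by rewrite divr_gt0.
  have E : r `^ xi * s `^ (1 - xi) = r * (s / r) `^ (1 - xi).
    rewrite -[in LHS](divfK (lt0r_neq0 r0) s) powRM ?ltW // mulrCA -powRD ?(gt_eqF r0) ?implybT //.
    by rewrite subrKC powRr1 ?(ltW r0) // mulrC.
  have : (s / r) `^ (1 - xi) <= (1 - xi) * (s / r) + xi.
    have q1 : (1 - xi)^-1^-1 + xi^-1^-1 = 1 by rewrite !invrK subrK.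
    have := conjugate_powR (powR_ge0 (s / r) (1 - xi)) ler01 _ _ q1.
    rewrite !invr_gt0 => /(_ y0 x0).
    rewrite -powRrM mulfV ?gt_eqF // powRr1 ?(ltW q0) // powR1 !invrK mul1r mulr1.
    by rewrite [(1 - xi) * _]mulrC.
  have rs : r * (s / r) = s by rewrite mulrC divfK ?gt_eqF.
  rewrite E; move: ((s / r) `^ (1 - xi)) => P hP.
  have := ler_wpM2l (ltW r0) hP.
  have -> : r * ((1 - xi) * (s / r) + xi) = (1 - xi) * s + r * xi by rewrite -{2}rs; ring.
  lra.
- exists (1 - xi)^-1 => r /andP[r0 r1]; rewrite ger0_norm; last first.
    by apply: divr_ge0; rewrite ?powR_ge0 ?(ltW y0).
  rewrite ler_piMl ?invr_ge0 ?(ltW y0) //.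
  by rewrite -[leRHS](powRr0 r) ger_powR ?r0 ?(ltW r1) ?(ltW y0).
Qed.

(** Subtracting the infimum of [phi], which is its limit at 0+, lets the inequality reach s = 0;
    this matters because the level gap may vanish along the sequence. *)
Lemma desing_normalize e W phi : desing e W phi -> exists psi : R -> R,
  [/\ psi 0 = 0, forall s r, 0 <= s -> s <= r -> r < e -> psi s <= psi r,
      forall s r, 0 <= s -> s <= r -> r < e -> r - s <= W r * (psi r - psi s) &
      forall eta, 0 < eta -> exists2 delta, 0 < delta & forall r, 0 <= r < delta -> psi r < eta].
Proof.
move=> D; have [e0 W0 mW key [B hB]] := D.
pose A := [set phi r | r in [set r : R | 0 < r < e]].
have A0 : A !=set0 by exists (phi (e / 2)); exists (e / 2) => //=; lra.
have lA : has_lbound A.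
  by exists (- B) => _ [r re <-]; have := hB r re; rewrite ler_norml => /andP[].
have iA : has_inf A by [].
pose m := inf A.
have mle r : 0 < r < e -> m <= phi r by move=> re; apply: ge_inf => //; exists r.
exists (fun r => if 0 < r then phi r - m else 0); split.
- by rewrite ltxx.
- move=> s r s0 sr re; have [s1|s1] := ltP 0 s.
    by rewrite (lt_le_trans s1 sr) lerD2r; exact: (desing_le D).
  by case: ifP => // r0; rewrite subr_ge0 mle // r0.
- move=> s r s0 sr re; have [s1|s1] := ltP 0 s.
    rewrite (lt_le_trans s1 sr); have [->|sr'] := eqVneq s r; first by rewrite !subrr mulr0.
    by have := key s r s1; rewrite lt_neqAle sr' sr => /(_ isT re); lra.
  have -> : s = 0 by lra.
  rewrite !subr0; case: ifP => r0; last by rewrite mulr0; lra.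
  (* For s = 0 the inequality is used from [eps] to [r], with [phi eps] replaced by its lower bound
     [m], and [eps] is arbitrary. *)
  apply/ler_addgt0Pl => eps eps0.
  have [re'|re'] := leP r eps.
    have := mle r ltac:(lra); have w := W0 r ltac:(lra).
    by rewrite -subr_ge0 => h; have := mulr_ge0 (ltW w) h; lra.
  have := key eps r eps0 re' re; have := mle eps ltac:(lra).
  have w := W0 r ltac:(lra); rewrite -(ler_pM2l w); lra.
- move=> eta eta0; have [_ [r /= re <-] hr] := inf_adherent eta0 iA.
  exists r => [|t /andP[t0 tr]]; first lra.
  case: ifP => // t1; have := desing_le D t1 (ltW tr) ltac:(lra); rewrite -/m in hr; lra.
Qed.

End DesingOps.

Section KLTwoSided.
Variables (R : realType) (d : nat) (f : 'rV[R]_d -> R) (L : R).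
Hypothesis df : forall x, differentiable f x.
Hypothesis L0 : 0 < L.
Hypothesis lipf : forall u v, enorm (grad f u - grad f v) <= L * enorm (u - v).
Hypothesis deff : definable_ominimal f.

Lemma gradN x : grad (fun y => - f y) x = - grad f x.
Proof.
by apply/rowP => j; rewrite !mxE -[fun y => - f y]/(- f) diffN.
Qed.

(** Both sides of the level occur: only a corrected quantity is monotone along the iterates, so f
    itself may drop below its limit value. The lower side is the upper one for -f at level -c. *)
Lemma KL_inequality (rho c : R) : 0 <= rho -> exists e W phi, desing e W phi /\
  forall x, enorm x <= rho -> 0 < `|f x - c| < e -> W `|f x - c| <= enorm (grad f x).
Proof.
move=> rho0; have [S [omS /dfn_fun_graph dS]] := deff.
have dSN : dfn_fun S (fun x => - f x).
  apply: (dfn_ext (P := fun p : ctx_prod (ctx_vec R d) (ctx_scal R) => f p.1 = - p.2)).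
    by move=> p; split => [->|<-]; rewrite opprK.
  apply: (dfn_subst2 (P := fun x a => f x = a) omS dS); first by polyfun_tac.
  by apply: polymap_scal; polyfun_tac.
have cf : continuous f by move=> x; exact: differentiable_continuous.
have cG : continuous (fun x => enorm (grad f x)).
  apply: (@lip_continuous _ _ L) => x y.
  exact: le_trans (enorm_dist _ _) (lipf x y).
have dfN x : differentiable (fun x => - f x) x.
  by rewrite -[fun y => - f y]/(- f); exact: differentiableN.
have cfN : continuous (fun x => - f x) by move=> x; exact: differentiable_continuous.
have lipN u v : enorm (grad (fun x => - f x) u - grad (fun x => - f x) v) <= L * enorm (u - v).
  by rewrite !gradN -opprD enormN.
have G_le x s (s0 : 0 <= s) := grad_norm_le df L0 lipf x s0.
have GN_le x s (s0 : 0 <= s) := grad_norm_le dfN L0 lipN x s0.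
have [e1 [W1 [p1 [D1 h1]]]] := KL_above omS c L0 (fun x => enorm_ge0 (grad f x)) G_le cf cG dS rho0.
have [|e2 [W2 [p2 [D2 h2]]]] := KL_above omS (f := fun x => - f x) (G := fun x => enorm (grad f x))
  (- c) L0 (fun x => enorm_ge0 (grad f x)) _ cfN cG dSN rho0.
  by move=> x s s0; have := GN_le x s s0; rewrite gradN enormN.
exists (Num.min e1 e2), (fun r => Num.min (W1 r) (W2 r)), (fun r => p1 r + p2 r).
split; first exact: desing_min.
move=> x xr; rewrite lt_min ge_min => /and3P[f0 f1 f2].
have [fc|fc] := leP 0 (f x - c).
  by rewrite ger0_norm // in f0 f1 *; rewrite h1 // f0.
rewrite ltr0_norm // in f0 f1 f2 *; rewrite [X in _ || X](_ : _ = true) ?orbT //.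
have E : - (f x - c) = - f x - - c by lra.
by rewrite E h2 // -E f0.
Qed.

(** At least half of [r] comes from [p] or from |f x - c|. In the first case p^xi bounds the power
    part of the minimum, in the second the gradient norm bounds the part coming from the KL
    inequality. *)
Lemma KL_perturbed (rho c xi : R) : 0 <= rho -> 0 < xi < 1 -> exists e W phi,
  [/\ desing e W phi & forall x r p, enorm x <= rho -> 0 <= p -> 0 < r < e ->
     `|f x - c| < e -> r <= `|f x - c| + p -> W r <= enorm (grad f x) + p `^ xi].
Proof.
move=> rho0 xi01; have [e [W [phi [D h]]]] := KL_inequality c rho0.
have E := desing_pow xi01.
exists (Num.min e 1), (fun r => Num.min (W (r / 2)) ((r / 2) `^ xi)),
  (fun r => 2 * phi (r / 2) + 2 * ((r / 2) `^ (1 - xi) / (1 - xi))).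
split; first exact: (desing_min (desing_half D) (desing_half E)).
move=> x r p xr p0; rewrite !lt_min => /and3P[r0 re r1] /andP[fe f1] rp.
have [_ _ mW _ _] := D.
have [pr|rp'] := leP (r / 2) p.
  rewrite ge_min; apply/orP; right; rewrite -[leLHS]add0r lerD ?enorm_ge0 //.
  by case/andP: xi01 => x0 _; rewrite ge0_ler_powR ?nnegrE //; lra.
rewrite ge_min; apply/orP; left; rewrite -[leLHS]addr0 lerD ?powR_ge0 //.
apply: le_trans (h x xr _); last by lra.
by apply: mW; lra.
Qed.

End KLTwoSided.

(** * Sequences with bounded partial sums *)

Section BoundedSums.
Variable R : realType.
Implicit Types a : nat -> R.

(** For nonnegative terms this is summability, in a form that is compared and added without limits;
    [bsum_cvgn] translates it. *)
Definition bsum a := exists B, forall N, \sum_(0 <= k < N) a k <= B.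

Lemma psum_le a m n : (forall k, 0 <= a k) -> (m <= n)%N ->
  \sum_(0 <= k < m) a k <= \sum_(0 <= k < n) a k.
Proof.
move=> a0 mn; rewrite (big_cat_nat (leq0n m) mn) /= lerDl.
by apply: sumr_ge0 => i _.
Qed.

Lemma bsum_tail a : (forall k, 0 <= a k) -> bsum a ->
  forall eta, 0 < eta -> exists K, forall n m, (K <= n)%N -> \sum_(n <= k < m) a k < eta.
Proof.
move=> a0 [B hB] eta eta0.
pose A := range (fun N => \sum_(0 <= k < N) a k).
have sA : has_sup A by split; [by exists (\sum_(0 <= k < 0) a k), 0%N|exists B => _ [N _ <-]].
have [_ [K _ <-] hK] := sup_adherent eta0 sA; exists K => n m Kn.
have [mn|nm] := leqP m n; first by rewrite big_geq.
have : \sum_(0 <= k < m) a k <= sup A by apply: ub_le_sup; [case: sA|exists m].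
rewrite (big_cat_nat (leq0n n) (ltnW nm)) /=; have := psum_le a0 Kn; lra.
Qed.

Lemma bsum_small a : (forall k, 0 <= a k) -> bsum a ->
  forall eta, 0 < eta -> exists K, forall n, (K <= n)%N -> a n < eta.
Proof.
move=> a0 aS eta eta0; have [K hK] := bsum_tail a0 aS eta0.
by exists K => n Kn; have := hK n n.+1 Kn; rewrite big_nat1.
Qed.

Lemma bsumW a a' : (forall k, a k <= a' k) -> bsum a' -> bsum a.
Proof.
by move=> aa' [B hB]; exists B => N; apply: le_trans (hB N); apply: ler_sum.
Qed.

Lemma bsumZ c a : 0 <= c -> bsum a -> bsum (fun k => c * a k).
Proof.
by move=> c0 [B hB]; exists (c * B) => N; rewrite -mulr_sumr ler_wpM2l.
Qed.

Lemma bsumD a a' : bsum a -> bsum a' -> bsum (fun k => a k + a' k).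
Proof.
by move=> [B hB] [B' hB']; exists (B + B') => N; rewrite big_split lerD.
Qed.

Lemma bsum_shift a K : (forall k, 0 <= a k) ->
  bsum a <-> bsum (fun k => a (K + k)%N).
Proof.
move=> a0.
have E N : \sum_(0 <= k < N) a (K + k)%N = \sum_(K <= k < K + N) a k.
  rewrite -{2}[K]add0n big_addn addKn; apply: eq_bigr => i _; by rewrite addnC.
split => -[B hB].
  exists B => N; rewrite E; apply: le_trans (hB (K + N)%N).
  rewrite [leRHS](big_cat_nat (leq0n K) (leq_addr N K)) /= lerDr.
  by apply: sumr_ge0.
exists (\sum_(0 <= k < K) a k + B) => N; apply: le_trans (psum_le a0 (leq_addl K N)) _.
by rewrite (big_cat_nat (leq0n K) (leq_addr N K)) /= lerD2l -E.
Qed.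

(** Summing the recursion gives sum v <= v 0 + q sum v + sum a, and the middle term is absorbed on
    the left. *)
Lemma bsum_contraction (q : R) a v : 0 <= q < 1 -> (forall k, 0 <= v k) ->
  (forall k, v k.+1 <= q * v k + a k) -> bsum a -> bsum v.
Proof.
move=> /andP[q0 q1] v0 hv [B hB]; exists ((v 0%N + B) / (1 - q)) => N.
rewrite ler_pdivlMr ?subr_gt0 //.
have key n : \sum_(0 <= k < n.+1) v k <=
    v 0%N + q * \sum_(0 <= k < n) v k + \sum_(0 <= k < n) a k.
  elim: n => [|n IH]; first by rewrite big_nat1 !big_geq // mulr0 !addr0.
  rewrite big_nat_recr //= [in X in _ <= _ + q * X + _]big_nat_recr //=.
  rewrite [X in _ <= _ + X]big_nat_recr //=; have := hv n; rewrite mulrDr; lra.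
have := key N; have := hB N; have := psum_le v0 (leqnSn N); lra.
Qed.

Lemma contraction_bounded (q c : R) v : 0 <= q < 1 -> 0 <= c -> (forall k, 0 <= v k) ->
  (forall k, v k.+1 <= q * v k + c) -> forall k, v k <= v 0%N + c / (1 - q).
Proof.
move=> /andP[q0 q1] c0 v0 hv; have d0 : 0 < 1 - q by lra.
have cE : c / (1 - q) * (1 - q) = c by rewrite divfK // gt_eqF.
have y0 : 0 <= c / (1 - q) by rewrite divr_ge0 // ltW.
elim=> [|k IH]; first by rewrite lerDl.
apply: le_trans (hv k) _; have := ler_wpM2l q0 IH; have := v0 0%N.
move: (c / (1 - q)) cE y0 => y cE y0 w0; nra.
Qed.

Lemma gronwall (c : R) a v : 0 <= c -> (forall k, 0 <= v k) -> (forall k, 0 <= a k) ->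
  (forall k, v k.+1 <= (1 + c * a k) * v k) -> bsum a -> exists B, forall k, v k <= B.
Proof.
move=> c0 v0 a0 hv [B hB]; exists (expR (c * B) * v 0%N) => k.
apply: (@le_trans _ _ (expR (c * \sum_(0 <= i < k) a i) * v 0%N)); last first.
  by rewrite ler_wpM2r // ler_expR ler_wpM2l.
elim: k => [|k IH]; first by rewrite big_geq // mulr0 expR0 mul1r.
apply: le_trans (hv k) _; rewrite big_nat_recr //= mulrDr expRD mulrAC mulrC.
apply: ler_pM => //; [by rewrite addr_ge0 // mulr_ge0|exact: expR_ge1Dx].
Qed.

End BoundedSums.

(** * Convergence of perturbed descent sequences *)

Section ScalarStep.
Variable R : realType.

(** Convexity of the square at q s + (1 - q) w with w = t / (1 - q). *)
Lemma sqr_convex (q s t : R) : 0 <= q -> q < 1 ->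
  (q * s + t) ^+ 2 <= q * s ^+ 2 + t ^+ 2 / (1 - q).
Proof.
move=> q0 q1; have d0 : 0 < 1 - q by lra.
pose w := t / (1 - q); have tE : t = (1 - q) * w by rewrite mulrC divfK // gt_eqF.
have -> : t ^+ 2 / (1 - q) = (1 - q) * w ^+ 2.
  by rewrite tE exprMn mulrAC expr2 mulfK // gt_eqF.
rewrite tE; have : 0 <= q * (1 - q) * (s - w) ^+ 2 by rewrite mulr_ge0 ?sqr_ge0 // mulr_ge0 // ltW.
lra.
Qed.

(** The drift contributes mr Cd al U, which a small [al] keeps within half of the gap 1 - bm; this
    is the origin of [q]. The bound al <= 1 then turns al^2 into al. *)
Lemma momentum_step (bm mr Cd c al U U' sF : R) :
  let q := (1 + bm) / 2 in let C := mr * (1 + Cd) * c in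
  0 < al <= 1 -> 0 <= U -> 0 <= sF -> 0 <= mr -> 0 <= Cd -> 0 <= c ->
  mr * Cd * al <= (1 - bm) / 2 ->
  U' <= bm * U + mr * al * (c * sF + Cd * (U + al * (c * sF))) ->
  U' <= q * U + C * al * sF.
Proof.
move=> q C /andP[al0 al1] U0 s0 m0 Cd0 c0 hal hU; apply: le_trans hU _.
have h1 := ler_wpM2r U0 hal.
have t0 : 0 <= mr * Cd * (c * sF) * al by rewrite !mulr_ge0 // ltW.
have h2 := ler_wpM2l t0 al1.
rewrite /q /C; lra.
Qed.

(** [M] is chosen so that the contraction loss M (1 - q) al U^2 cancels exactly the term kp Cd^2 al
    U^2 of the epoch error; only terms in al^3 sF^2 survive. *)
Lemma lyapunov_step (q C M kp Cd c al al' U U' sF F' X : R) :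
  M = kp * Cd ^+ 2 / (1 - q) ->
  0 <= q -> q < 1 -> 0 < al -> al' <= al -> 0 <= U -> 0 <= U' -> 0 <= sF -> 0 <= C ->
  0 < kp ->
  U' <= q * U + C * al * sF ->
  F' <= sF ^+ 2 - X + kp * al / 2 * (Cd * (U + al * (c * sF))) ^+ 2 ->
  F' + M * al' * U' ^+ 2 <= sF ^+ 2 + M * al * U ^+ 2 - X
    + (kp * Cd ^+ 2 * c ^+ 2 + M * C ^+ 2 / (1 - q)) * al ^+ 3 * sF ^+ 2.
Proof.
move=> ME q0 q1 al0 aal U0 U'0 s0 C0 kp0 hU hF.
have d0 : 0 < 1 - q by lra.
have MQ : M * (1 - q) = kp * Cd ^+ 2 by rewrite ME divfK // gt_eqF.
have M0 : 0 <= M by rewrite ME divr_ge0 ?(ltW d0) // mulr_ge0 ?sqr_ge0 // ltW.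
have h1 : M * al' * U' ^+ 2 <= M * al * U' ^+ 2.
  by rewrite ler_wpM2r ?sqr_ge0 // ler_wpM2l.
have h2 : U' ^+ 2 <= q * U ^+ 2 + (C * al * sF) ^+ 2 / (1 - q).
  apply: le_trans (sqr_convex U (C * al * sF) q0 q1).
  rewrite ler_sqr ?nnegrE //; exact: le_trans hU.
have h3 := ler_wpM2l (mulr_ge0 M0 (ltW al0)) h2.
have h4 : (U + al * (c * sF)) ^+ 2 <= 2 * U ^+ 2 + 2 * (al * (c * sF)) ^+ 2.
  have := sqr_ge0 (U - al * (c * sF)); lra.
have k0 : 0 <= kp * al / 2 * Cd ^+ 2.
  by rewrite mulr_ge0 ?sqr_ge0 // divr_ge0 // mulr_ge0 // ltW.
have h5 := ler_wpM2l k0 h4.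
have E1 : kp * al / 2 * (Cd * (U + al * (c * sF))) ^+ 2 =
  kp * al / 2 * Cd ^+ 2 * (U + al * (c * sF)) ^+ 2 by ring.
have E2 : M * al * (q * U ^+ 2 + (C * al * sF) ^+ 2 / (1 - q)) =
  M * al * U ^+ 2 - M * (1 - q) * al * U ^+ 2 + M * C ^+ 2 / (1 - q) * al ^+ 3 * sF ^+ 2.
  by field; rewrite gt_eqF.
rewrite E1 in hF; rewrite E2 MQ in h3.
have -> : (kp * Cd ^+ 2 * c ^+ 2 + M * C ^+ 2 / (1 - q)) * al ^+ 3 * sF ^+ 2 =
    kp * Cd ^+ 2 * c ^+ 2 * al ^+ 3 * sF ^+ 2 + M * C ^+ 2 / (1 - q) * al ^+ 3 * sF ^+ 2.
  by rewrite !mulrDl.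
move: (M * C ^+ 2 / (1 - q) * al ^+ 3 * sF ^+ 2) h3 => t h3; lra.
Qed.

End ScalarStep.

Section KLStep.
Variable R : realType.

(** Here [P] is the decrease of the desingularizing function and [e] the error p^xi. One quadratic
    inequality yields both the weighted gradient and the displacement. *)
Lemma kl_step (a G D e P : R) : 0 < a -> 0 <= G -> 0 <= D -> 0 <= e -> 0 <= P ->
  a / 2 * G ^+ 2 + D ^+ 2 / (4 * a) <= (G + e) * P ->
  a * G <= 8 * P + a * e /\ D <= 8 * P + a * e.
Proof.
move=> a0 G0 D0 e0 P0 h.
have h' : 2 * (a * G) ^+ 2 + D ^+ 2 <= 4 * (a * G + a * e) * P.
  have := ler_wpM2l (mulr_ge0 (ler0n R 4) (ltW a0)) h.
  have -> : 4%:R * a * (a / 2 * G ^+ 2 + D ^+ 2 / (4 * a)) = 2 * (a * G) ^+ 2 + D ^+ 2.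
    by field; rewrite gt_eqF.
  by lra.
have x0 : 0 <= a * G by rewrite mulr_ge0 // ltW.
have y0 : 0 <= a * e by rewrite mulr_ge0 // ltW.
move: (a * G) (a * e) x0 y0 h' => x y x0 y0 h'.
(* Applied to the larger of [x] and [D]. Either X <= y, or X + y <= 2 X and the inequality can be
   divided by X. *)
suff H X : 0 <= X -> x <= X -> X ^+ 2 <= 4 * (X + y) * P -> X <= 8 * P + y.
  have D2 := sqr_ge0 D; have x2 := sqr_ge0 x.
  have [Dx|xD] := leP D x.
    have hx : x <= 8 * P + y by apply: H => //; lra.
    by split => //; exact: le_trans hx.
  have hD : D <= 8 * P + y.
    apply: H => //; first exact: ltW.
    have : 4 * (x + y) * P <= 4 * (D + y) * P by rewrite ler_wpM2r //; lra.
    lra.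
  by split => //; apply: le_trans hD; exact: ltW.
move=> X0 xX hX; have [Xy|yX] := leP X y; first lra.
have X1 : 0 < X by lra.
have : X * X <= X * (8 * P).
  apply: le_trans (_ : X ^+ 2 <= _) _; first by rewrite expr2.
  apply: le_trans hX _; have : (X + y) * P <= (X + X) * P by rewrite ler_wpM2r //; lra.
  lra.
by rewrite ler_pM2l //; lra.
Qed.

End KLStep.

Section Convergence.
Variables (R : realType) (d : nat) (f : 'rV[R]_d -> R) (L fbar : R).
Hypothesis df : forall x, differentiable f x.
Hypothesis L0 : 0 < L.
Hypothesis lipf : forall u v, enorm (grad f u - grad f v) <= L * enorm (u - v).
Hypothesis deff : definable_ominimal f.
Hypothesis fge : forall x, fbar <= f x.
Variables (z : nat -> 'rV[R]_d) (al U : nat -> R) (q C M kap C3 xi rho0 : R).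
Hypothesis al_gt0 : forall k, 0 < al k.
Hypothesis al_le1 : forall k, al k <= 1.
Hypothesis al_dec : forall k, al k.+1 <= al k.
Hypothesis xi01 : 0 < xi < 1.
Hypothesis al_sum : bsum (fun k => al k `^ (1 + xi)).
Hypothesis U0 : forall k, 0 <= U k.
Hypothesis q01 : 0 <= q < 1.
Hypothesis C0 : 0 <= C.
Hypothesis M0 : 0 <= M.
Hypothesis kap0 : 0 < kap.
Hypothesis C30 : 0 <= C3.
Let F k := f (z k) - fbar.
Let G k := enorm (grad f (z k)).
Let D k := enorm (z k.+1 - z k).
Hypothesis HU : forall k, U k.+1 <= q * U k + C * al k * Num.sqrt (F k).
Hypothesis HF : forall k, F k.+1 + M * al k.+1 * U k.+1 ^+ 2 <=
  F k + M * al k * U k ^+ 2 - (kap * al k / 2 * G k ^+ 2 + D k ^+ 2 / (4 * (kap * al k)))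
  + C3 * al k ^+ 3 * F k.
Hypothesis recur : forall K, exists2 k, (K <= k)%N & enorm (z k) <= rho0.

Let Phi k := F k + M * al k * U k ^+ 2.

Let F_ge0 k : 0 <= F k. Proof. by rewrite subr_ge0. Qed.

Let F_le k : F k <= Phi k.
Proof. by rewrite lerDl mulr_ge0 ?sqr_ge0 // mulr_ge0 // ltW. Qed.

Let Phi_ge0 k : 0 <= Phi k. Proof. exact: le_trans (F_le k). Qed.

Let al2_ge0 k : 0 <= al k ^+ 2. Proof. exact: sqr_ge0. Qed.

Let bsum_al2 : bsum (fun k => al k ^+ 2).
Proof.
apply: bsumW al_sum => k; rewrite -powR_mulrn ?(ltW (al_gt0 k)) // ger_powR ?al_gt0 ?al_le1 //.
by case/andP: xi01 => _ x1; rewrite -(natr1 1) lerD2l ltW.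
Qed.

Let al_le j k : (j <= k)%N -> al k <= al j.
Proof.
elim: k => [|k IH]; first by rewrite leqn0 => /eqP ->.
by rewrite leq_eqVlt ltnS => /predU1P[->//|/IH]; exact: le_trans.
Qed.

Let descent_ge0 k : 0 <= kap * al k / 2 * G k ^+ 2 + D k ^+ 2 / (4 * (kap * al k)).
Proof.
have a0 : 0 < kap * al k by rewrite mulr_gt0.
apply: addr_ge0; first by rewrite mulr_ge0 ?sqr_ge0 // divr_ge0 // ltW.
by rewrite divr_ge0 ?sqr_ge0 // mulr_ge0 // ltW.
Qed.

(** The error is at most C3 al^2 Phi since steps are at most 1, and al^2 <= al^(1+xi) is summable,
    so [gronwall] applies. *)
Lemma Phi_bounded : exists2 B, 0 <= B & forall k, Phi k <= B.
Proof.
have [B hB] : exists B, forall k, Phi k <= B.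
  apply: (@gronwall R C3 (fun k => al k ^+ 2)) => // k.
  apply: le_trans (HF k) _; rewrite [leRHS]mulrDl mul1r.
  have : C3 * al k ^+ 3 * F k <= C3 * al k ^+ 2 * Phi k.
    apply: ler_pM => //; first by rewrite mulr_ge0 // exprn_ge0 // ltW.
    rewrite ler_wpM2l // exprSr ler_piMr //.
  by have := descent_ge0 k; rewrite /Phi; lra.
by exists B => //; exact: le_trans (hB 0%N).
Qed.

Lemma U_bounded : exists2 B, 0 <= B & forall k, U k <= B.
Proof.
have [B B0 hB] := Phi_bounded.
have c0 : 0 <= C * Num.sqrt B by rewrite mulr_ge0 // sqrtr_ge0.
have H := @contraction_bounded R q _ U q01 c0 U0 _.
eexists; last first.
  apply: H => k; apply: le_trans (HU k) _; rewrite lerD2l -mulrA ler_wpM2l //.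
  apply: le_trans (_ : _ <= 1 * Num.sqrt (F k)) _; first by rewrite ler_wpM2r // sqrtr_ge0.
  by rewrite mul1r ler_wsqrtr // (le_trans (F_le k)).
by rewrite addr_ge0 // divr_ge0 //; case/andP: q01 => _ q1; rewrite subr_ge0 ltW.
Qed.

(** Weighting by nonincreasing steps keeps the factor [q] and makes the source O(al^2). The sum
    later pays for replacing z by x in the weighted gradients. *)
Lemma bsum_alU : bsum (fun k => al k * U k).
Proof.
have [B B0 hB] := Phi_bounded.
have sB : 0 <= C * Num.sqrt B by rewrite mulr_ge0 // sqrtr_ge0.
apply: (@bsum_contraction R q (fun k => C * Num.sqrt B * al k ^+ 2)) => //.
- by move=> k; rewrite mulr_ge0 // ltW.
- move=> k; apply: (@le_trans _ _ (al k * U k.+1)); first by rewrite ler_wpM2r.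
  have sF : Num.sqrt (F k) <= Num.sqrt B by rewrite ler_wsqrtr // (le_trans (F_le k)).
  have h : C * al k * Num.sqrt (F k) <= C * al k * Num.sqrt B.
    by rewrite ler_wpM2l // mulr_ge0 // ltW.
  have := ler_wpM2l (ltW (al_gt0 k)) (HU k).
  have := ler_wpM2l (ltW (al_gt0 k)) h; nra.
- exact: bsumZ.
Qed.

(** Forces [U] to 0, whence x and z have the same limit. *)
Lemma bsum_U2 : bsum (fun k => U k ^+ 2).
Proof.
have [B B0 hB] := Phi_bounded.
have [q0 q1] := andP q01; have d0 : 0 < 1 - q by rewrite subr_gt0.
apply: (@bsum_contraction R q (fun k => C ^+ 2 * B / (1 - q) * al k ^+ 2)) => //.
- by move=> k; exact: sqr_ge0.
- move=> k; apply: le_trans (_ : _ <= (q * U k + C * al k * Num.sqrt (F k)) ^+ 2) _.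
    by rewrite ler_sqr ?nnegrE //; exact: le_trans (HU k).
  apply: le_trans (sqr_convex _ _ q0 q1) _; rewrite lerD2l !exprMn sqr_sqrtr //.
  rewrite [leRHS]mulrAC ler_pM2r ?invr_gt0 // [leRHS]mulrAC.
  apply: ler_wpM2l; first by rewrite mulr_ge0 ?sqr_ge0.
  exact: le_trans (F_le k) (hB k).
- by apply: bsumZ => //; rewrite divr_ge0 ?(ltW d0) // mulr_ge0 ?sqr_ge0.
Qed.

(* delta k is the tail of the error series, which turns the almost monotone
   sequence Phi into the monotone sequence Phi + delta. *)
Lemma level_gap : exists (l C5 : R) (r p : nat -> R), 0 <= C5 /\
  [/\ forall k, 0 <= r k,
      forall k, r k.+1 + (kap * al k / 2 * G k ^+ 2 + D k ^+ 2 / (4 * (kap * al k))) <= r k,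
      forall eta, 0 < eta -> exists k, r k < eta,
      forall k, 0 <= p k <= C5 * al k &
      forall k, r k = F k - l + p k].
Proof.
have [B B0 hB] := Phi_bounded; have [V V0 hV] := U_bounded.
have [Q hQ] := bsum_al2.
have al3 k : 0 <= al k ^+ 3 by rewrite exprn_ge0 // ltW.
have al32 k : al k ^+ 3 <= al k ^+ 2 by rewrite exprSr ler_piMr.
pose A := range (fun N => \sum_(0 <= k < N) al k ^+ 3).
have sA : has_sup A.
  split; first by exists (\sum_(0 <= k < 0) al k ^+ 3), 0%N.
  by exists Q => _ [N _ <-]; apply: le_trans (hQ N); apply: ler_sum.
pose dl k := C3 * B * (sup A - \sum_(0 <= j < k) al j ^+ 3).
have CB : 0 <= C3 * B by rewrite mulr_ge0.
have dl0 k : 0 <= dl k.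
  by rewrite mulr_ge0 // subr_ge0; apply: ub_le_sup; [case: sA|exists k].
have Q0 : 0 <= Q by have := hQ 0%N; rewrite big_geq.
(* By monotonicity of the steps, the tail of the cubes is at most [al k] times the sum [Q] of
   squares. *)
have dl1 k : dl k <= C3 * B * Q * al k.
  rewrite -mulrA ler_wpM2l // lerBlDr; apply: ge_sup; first by case: sA.
  move=> _ [N _ <-]; have aQ : 0 <= Q * al k by rewrite mulr_ge0 // ltW.
  have [Nk|kN] := leqP N k.
    by have := psum_le al3 Nk; lra.
  rewrite (big_cat_nat (leq0n k) (ltnW kN)) /= addrC lerD2r.
  apply: (@le_trans _ _ (\sum_(k <= i < N) al k * al i ^+ 2)).
    rewrite !big_nat; apply: ler_sum => i /andP[ki _].
    by rewrite exprS ler_wpM2r // al_le.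
  rewrite -mulr_sumr mulrC ler_wpM2r ?(ltW (al_gt0 k)) //; apply: le_trans (hQ N).
  by rewrite [leRHS](big_cat_nat (leq0n k) (ltnW kN)) /= lerDr sumr_ge0.
pose Psi k := Phi k + dl k.
have Psi0 k : 0 <= Psi k by rewrite addr_ge0.
have PsiD k : Psi k.+1 + (kap * al k / 2 * G k ^+ 2 + D k ^+ 2 / (4 * (kap * al k))) <= Psi k.
  have dlS : dl k = dl k.+1 + C3 * B * al k ^+ 3.
    by rewrite /dl big_nat_recr //=; ring.
  have : C3 * al k ^+ 3 * F k <= C3 * al k ^+ 3 * B.
    by apply: ler_wpM2l; [exact: mulr_ge0|exact: le_trans (F_le k) (hB k)].
  have := HF k; rewrite /Psi dlS /Phi; lra.
pose E := range Psi.
have iE : has_inf E by split; [by exists (Psi 0%N), 0%N|exists 0 => _ [k _ <-]].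
(* The limit level is measured from [fbar], so the KL inequality is later taken at [l + fbar]. All
   corrections to [F] are gathered in the O(al) term. *)
exists (inf E), (M * V ^+ 2 + C3 * B * Q), (fun k => Psi k - inf E),
  (fun k => M * al k * U k ^+ 2 + dl k).
split; first by rewrite addr_ge0 ?mulr_ge0 ?sqr_ge0.
split.
- by move=> k; rewrite subr_ge0; apply: ge_inf; [case: iE|exists k].
- by move=> k; have := PsiD k; lra.
- move=> eta eta0; have [_ [k _ <-] hk] := inf_adherent eta0 iE.
  by exists k; lra.
- move=> k; have Ma : 0 <= M * al k by rewrite mulr_ge0 // ltW.
  apply/andP; split; first by apply: addr_ge0 => //; rewrite mulr_ge0 // sqr_ge0.
  rewrite [leRHS]mulrDl; apply: lerD => //.
  by rewrite [leRHS]mulrAC ler_wpM2l // ler_sqr ?nnegrE.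
- by move=> k; rewrite /Psi /Phi; ring.
Qed.

Theorem kl_convergence : bsum D /\ bsum (fun k => al k * G k).
Proof.
have [l [C5 [r [p [C50 [r0 rD rinf p01 rE]]]]]] := level_gap.
have x0 : 0 < xi by case/andP: xi01.
have rdec j k : (j <= k)%N -> r k <= r j.
  elim: k => [|k IH]; first by rewrite leqn0 => /eqP ->.
  rewrite leq_eqVlt ltnS => /predU1P[->//|/IH].
  by apply: le_trans; have := rD k; have := descent_ge0 k; lra.
have rho10 : 0 <= rho0 + 1.
  by have [k _ hk] := recur 0; have := enorm_ge0 (z k); lra.
have [e [W [phi [Dd hW]]]] := KL_perturbed df L0 lipf deff (l + fbar) rho10 xi01.
have [psi [psi0 psi_mono psi_key psi_lim]] := desing_normalize Dd.
have e0 : 0 < e by case: Dd.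
have W0 : forall r, 0 < r < e -> 0 < W r by case: Dd.
(* The error per step: as p = O(al), it is O(al^(1+xi)). *)
pose ep k := kap * al k * p k `^ xi.
have ep0 k : 0 <= ep k by rewrite mulr_ge0 ?powR_ge0 // mulr_ge0 // ltW.
have ep_sum : bsum ep.
  apply: bsumW (bsumZ (_ : 0 <= kap * C5 `^ xi) al_sum) => [k|]; last first.
    by rewrite mulr_ge0 ?powR_ge0 // ltW.
  have /andP[pk0 pk1] := p01 k.
  rewrite powRD; last by rewrite gt_eqF //; lra.
  rewrite powRr1 ?(ltW (al_gt0 k)) // /ep.
  have : p k `^ xi <= C5 `^ xi * al k `^ xi.
    rewrite -powRM ?(ltW (al_gt0 k)) // ge0_ler_powR ?nnegrE ?(ltW x0) //.
    by rewrite mulr_ge0 // ltW.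
  have ka : 0 <= kap * al k by rewrite mulr_ge0 // ltW.
  by move/(ler_wpM2l ka); lra.
have step k : r k < e -> p k < e -> enorm (z k) <= rho0 + 1 ->
    kap * al k * G k <= 8 * (psi (r k) - psi (r k.+1)) + ep k /\
    D k <= 8 * (psi (r k) - psi (r k.+1)) + ep k.
  move=> re pe zk; have /andP[pk0 pk1] := p01 k.
  have rr : r k.+1 <= r k by exact: rdec.
  have P0 : 0 <= psi (r k) - psi (r k.+1) by rewrite subr_ge0 psi_mono.
  have a0 : 0 < kap * al k by rewrite mulr_gt0.
  apply: kl_step => //; [exact: enorm_ge0|exact: enorm_ge0|exact: powR_ge0|].
  (* At gap 0 the KL inequality is silent, but the descent then already makes the left side
     nonpositive. *)
  have := rD k; have [rk0|rk0] := ltP 0 (r k); last first.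
    have := r0 k.+1; have : 0 <= (G k + p k `^ xi) * (psi (r k) - psi (r k.+1)).
      by rewrite mulr_ge0 // addr_ge0 ?powR_ge0 ?enorm_ge0.
    lra.
  have FE : f (z k) - (l + fbar) = r k - p k by rewrite rE /F; lra.
  have Wle : W (r k) <= G k + p k `^ xi.
    apply: hW => //; first by rewrite rk0.
      by rewrite FE ltr_norml; lra.
    by rewrite FE; have := ler_norm (r k - p k); lra.
  have := psi_key _ _ (r0 k.+1) rr re; have := ler_wpM2r P0 Wle; lra.
(* Length budget: 8/32 = 1/4 from [psi] and 1/2 from the errors stay below the margin 1 of the
   ball. *)
have [d1 d10 hd1] := psi_lim (1 / 16 / 2) ltac:(lra).
have [K1 hK1] : exists K, forall k, (K <= k)%N -> r k < Num.min e d1.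
  have [k hk] := rinf (Num.min e d1) ltac:(by rewrite lt_min e0).
  by exists k => j kj; apply: le_lt_trans hk; exact: rdec.
have [K2 hK2] := bsum_tail ep0 ep_sum (eta := 1 / 2) ltac:(lra).
have [K3 hK3] : exists K, forall k, (K <= k)%N -> p k < e.
  have c1 : 0 < C5 + 1 by lra.
  have [K hK] := bsum_small al2_ge0 bsum_al2 (eta := (e / (C5 + 1)) ^+ 2)
    ltac:(by rewrite exprn_gt0 // divr_gt0).
  exists K => k /hK; rewrite ltr_sqr ?nnegrE ?(ltW (al_gt0 k)) ?(ltW (divr_gt0 e0 c1)) //.
  rewrite ltr_pdivlMr // => h; have /andP[_] := p01 k; have := al_gt0 k; lra.
have [K /= hK zK] := recur (maxn K1 (maxn K2 K3)).
move: hK; rewrite !geq_max => /and3P[k1 k2 k3].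
have sE N : \sum_(K <= k < K + N) ep k < 1 / 2 by exact: hK2.
have rK k : (K <= k)%N -> r k < e.
  by move=> Kk; have := hK1 k (leq_trans k1 Kk); rewrite lt_min => /andP[].
have psiK : psi (r K) < 1 / 16 / 2.
  by apply: hd1; rewrite r0; have := hK1 K k1; rewrite lt_min => /andP[].
have psi_ge0 k : (K <= k)%N -> 0 <= psi (r k).
  by move=> Kk; rewrite -psi0 psi_mono // rK.
(* Membership in the ball and the length bound must be proved together: each step needs the former,
   and the latter renews it. *)
have main N : enorm (z (K + N)%N) <= rho0 + 1 /\
    \sum_(K <= k < K + N) D k <=
      8 * (psi (r K) - psi (r (K + N)%N)) + \sum_(K <= k < K + N) ep k /\
    \sum_(K <= k < K + N) kap * al k * G k <=
      8 * (psi (r K) - psi (r (K + N)%N)) + \sum_(K <= k < K + N) ep k /\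
    enorm (z (K + N)%N - z K) <= \sum_(K <= k < K + N) D k.
  elim: N => [|N [zN [sD [sG zD]]]].
    by rewrite addn0 !big_geq // !subrr enorm0; split; [lra|split; [lra|split; lra]].
  have KN : (K <= K + N)%N by rewrite leq_addr.
  have [stG stD] := step _ (rK _ KN) (hK3 _ (leq_trans k3 KN)) zN.
  rewrite addnS !big_nat_recr //=.
  have zD' : enorm (z (K + N).+1 - z K) <= \sum_(K <= k < K + N) D k + D (K + N)%N.
    by have := enorm_triangle (z (K + N).+1) (z (K + N)%N) (z K); rewrite -/(D _); lra.
  have sD' : \sum_(K <= k < K + N) D k + D (K + N)%N <=
    8 * (psi (r K) - psi (r (K + N).+1)) + (\sum_(K <= k < K + N) ep k + ep (K + N)%N) by lra.
  split; last by split; [|split; [lra|]].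
  have := sE N.+1; rewrite addnS big_nat_recr //= => sE'.
  have := psi_ge0 (K + N).+1 (leqW KN).
  have := enormD (z (K + N).+1 - z K) (z K); rewrite subrK; lra.
have E a N : \sum_(0 <= k < N) a (K + k)%N = \sum_(K <= k < K + N) a k :> R.
  by rewrite -{2}[K]add0n big_addn addKn; apply: eq_bigr => i _; rewrite addnC.
split.
  apply/(bsum_shift K) => [k|]; first exact: enorm_ge0.
  exists 1 => N; rewrite (E D); have [_ [sD _]] := main N.
  have := sE N; have := psi_ge0 (K + N)%N (leq_addr _ _); lra.
apply/(bsum_shift K) => [k|]; first by rewrite mulr_ge0 ?enorm_ge0 // ltW.
apply: (bsumW (a' := fun k => kap^-1 * (kap * al (K + k)%N * G (K + k)%N))).
  by move=> k; rewrite !mulrA mulVf ?gt_eqF // mul1r.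
apply: bsumZ; first by rewrite invr_ge0 ltW.
exists 1 => N; rewrite (E (fun k => kap * al k * G k)); have [_ [_ [sG _]]] := main N.
have := sE N; have := psi_ge0 (K + N)%N (leq_addr _ _); lra.
Qed.

End Convergence.

(** * Estimates for one epoch of RRM *)

Section Blocks.
Variables (n b m : nat).
Hypothesis b0 : (0 < b)%N.
Hypothesis nbm : n = (b * m)%N.

(** The block of [j] is its quotient by [b], so every index lies in exactly one. *)
Lemma block_partition (V : zmodType) (F : 'I_n -> V) :
  \sum_(i < m) \sum_(j < n | (i * b <= j < i.+1 * b)%N) F j = \sum_(j < n) F j.
Proof.
rewrite (exchange_big_dep predT) //=; apply: eq_bigr => j _.
have jm : (j %/ b < m)%N by rewrite ltn_divLR // mulnC -nbm.
rewrite (big_pred1 (Ordinal jm)) // => i.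
by rewrite /= -leq_divRL // -ltn_divLR // ltnS -eqn_leq.
Qed.

Lemma block_const (R : realType) (c : R) i : (i < m)%N ->
  \sum_(j < n | (i * b <= j < i.+1 * b)%N) c = b%:R * c.
Proof.
move=> im.
have le : (i.+1 * b <= n)%N by rewrite nbm mulnC leq_mul2l im orbT.
transitivity (\sum_(i * b <= j < i.+1 * b) c); last first.
  by rewrite big_const_nat -mulnBl subSnn mul1n iter_addr_0 mulr_natl.
rewrite (big_nat_widenl _ 0%N) // (big_nat_widen _ _ n) // big_mkord.
by apply: eq_bigl => j.
Qed.

End Blocks.

Section Mean.
Variables (R : realType) (d n : nat) (fi : 'I_n -> 'rV[R]_d -> R).
Hypothesis dfi : forall i x, differentiable (fi i) x.
Let f := fun v => n%:R^-1 * \sum_(i < n) fi i v.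

Let fE : f = n%:R^-1 \*: (\sum_(i < n) fi i).
Proof. by apply/funext => v; rewrite /f fct_sumE. Qed.

Lemma diff_mean x : differentiable f x.
Proof. by rewrite fE; apply: differentiableZ; exact: differentiable_sum. Qed.

Lemma grad_mean x : grad f x = n%:R^-1 *: \sum_(i < n) grad (fi i) x.
Proof.
apply/rowP => j; rewrite !mxE summxE -deriveE; last exact: diff_mean.
rewrite fE deriveZ; last by apply: diff_derivable; exact: differentiable_sum.
rewrite derive_sum; last by move=> i; exact: diff_derivable.
by congr (_ * _); apply: eq_bigr => i _; rewrite mxE deriveE.
Qed.

Variables (L fbar : R).
Hypothesis n0 : (0 < n)%N.
Hypothesis lipfi : forall i u v, enorm (grad (fi i) u - grad (fi i) v) <= L * enorm (u - v).
Hypothesis fige : forall i v, fbar <= fi i v.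

Let nR : 0 < n%:R :> R. Proof. by rewrite ltr0n. Qed.

Lemma lip_mean u v : enorm (grad f u - grad f v) <= L * enorm (u - v).
Proof.
rewrite !grad_mean -scalerBr -sumrB enormZ ger0_norm ?invr_ge0 // ler_pdivrMl //.
apply: le_trans (enorm_sum _ _ _) _.
apply: (@le_trans _ _ (\sum_(i < n) L * enorm (u - v))); first by apply: ler_sum.
by rewrite sumr_const card_ord mulr_natl.
Qed.

Let mean_gap v : n%:R * (f v - fbar) = \sum_(i < n) (fi i v - fbar).
Proof.
by rewrite sumrB sumr_const card_ord /f mulrBr mulVKf ?gt_eqF // mulr_natl.
Qed.

Lemma mean_ge v : fbar <= f v.
Proof.
rewrite -subr_ge0 -(pmulr_rge0 _ nR) mean_gap sumr_ge0 // => i _.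
by rewrite subr_ge0.
Qed.

(** All gaps are nonnegative, so one is at most their sum. This is how f alone controls every
    component gradient. *)
Lemma component_gap i v : fi i v - fbar <= n%:R * (f v - fbar).
Proof.
rewrite mean_gap (bigD1 i) //= lerDl sumr_ge0 // => j _.
by rewrite subr_ge0.
Qed.

End Mean.

Section Epoch.
Variables (R : realType) (d n b m : nat) (fi : 'I_n -> 'rV[R]_d -> R) (L beta lambda : R).
Hypothesis n0 : (0 < n)%N.
Hypothesis b0 : (0 < b)%N.
Hypothesis nbm : n = (b * m)%N.
Hypothesis dfi : forall i x, differentiable (fi i) x.
Hypothesis L0 : 0 < L.
Hypothesis lipfi : forall i u v, enorm (grad (fi i) u - grad (fi i) v) <= L * enorm (u - v).
Hypothesis beta01 : 0 <= beta < 1.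
Hypothesis lambda01 : 0 <= lambda <= beta / (1 - beta).
Let f := fun v => n%:R^-1 * \sum_(i < n) fi i v.
Let kap := beta / (1 - beta).

(** Growth constant of the inner loop: times [S], it bounds both the momentum and the displacement
    of the proxy after [i] inner steps. The step size is absent because it is at most 1. *)
Fixpoint drift (i : nat) : R :=
  if i is i'.+1 then drift i' + (1 - beta)^-1 * (1 + L * (kap + 1) * drift i') else 1.

Let ob : 0 < 1 - beta. Proof. by case/andP: beta01 => _; rewrite subr_gt0. Qed.
Let beta0 : 0 <= beta. Proof. by case/andP: beta01. Qed.
Let iob : 1 <= (1 - beta)^-1.
Proof.
rewrite -[leLHS]invr1 lef_pV2 ?posrE //.
by rewrite lerBlDr lerDl. Qed.
Let kap0 : 0 <= kap. Proof. by rewrite divr_ge0 // ltW. Qed.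

Lemma drift_ge0 i : 0 <= drift i.
Proof.
elim: i => //= i IH; rewrite addr_ge0 // mulr_ge0 ?invr_ge0 ?(ltW ob) //.
by rewrite addr_ge0 // !mulr_ge0 ?(ltW L0) // addr_ge0.
Qed.

Lemma drift_le i j : (i <= j)%N -> drift i <= drift j.
Proof.
elim: j => [|j IH]; first by rewrite leqn0 => /eqP ->.
rewrite leq_eqVlt ltnS => /predU1P[->//|/IH h]; apply: le_trans h _ => /=.
rewrite lerDl mulr_ge0 ?invr_ge0 ?(ltW ob) // addr_ge0 // mulr_ge0 ?drift_ge0 //.
by rewrite mulr_ge0 ?(ltW L0) // addr_ge0.
Qed.

Variables (al g : R) (s : 'S_n) (y : nat -> 'rV[R]_d).
Hypothesis al01 : 0 < al <= 1.
(** Indices are shifted to start at 0: for epoch k, [u 0] and [u m] are x - xt at k and k + 1, and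
    [z 0], [z m] below are the proxies at k and k + 1. *)
Let u i := y i.+1 - y i.
Let z i := (1 - beta)^-1 *: y i.+1 - kap *: y i.
Let yh i := y i.+1 + lambda *: (y i.+1 - y i).
Let dd i := b%:R^-1 *: \sum_(j < n | (i * b <= j < i.+1 * b)%N) grad (fi (s j)) (yh i).
Hypothesis hy : forall i, (i < m)%N -> y i.+2 = y i.+1 - al *: dd i + beta *: (y i.+1 - y i).
Hypothesis hg : forall j, enorm (grad (fi j) (z 0%N)) <= g.

Let S := enorm (u 0%N) + al * g.
Let al0 : 0 < al. Proof. by case/andP: al01. Qed.
Let al1 : al <= 1. Proof. by case/andP: al01. Qed.
Let bR : 0 < b%:R :> R. Proof. by rewrite ltr0n. Qed.

Let g0 : 0 <= g. Proof. exact: le_trans (enorm_ge0 _) (hg (Ordinal n0)). Qed.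
Let S0 : 0 <= S. Proof. by apply: addr_ge0; [exact: enorm_ge0|rewrite mulr_ge0 // ltW]. Qed.

Let uS i : (i < m)%N -> u i.+1 = beta *: u i - al *: dd i.
Proof.
by move=> im; rewrite /u hy //; move: (dd i) => v; apply/rowP => j; rewrite !mxE; ring.
Qed.

(** The momentum cancels because z i = (y i.+1 - beta y i) / (1 - beta). *)
Let zS i : (i < m)%N -> z i.+1 = z i - (al / (1 - beta)) *: dd i.
Proof.
move=> im; rewrite /z hy //; move: (dd i) => v; apply/rowP => j; rewrite !mxE /kap.
by field; rewrite gt_eqF.
Qed.

(** [z i] is itself an extrapolation, with parameter [kap]; for 0 <= lambda <= kap the factor has
    modulus at most [kap]. *)
Let yhz i : yh i - z i = (lambda - kap) *: u i.
Proof.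
apply/rowP => j; rewrite /yh /z /u !mxE /kap; field; by rewrite gt_eqF.
Qed.

Let yh_dist i A : enorm (u i) <= A -> enorm (z i - z 0%N) <= A ->
  enorm (yh i - z 0%N) <= (kap + 1) * A.
Proof.
move=> hu hz; apply: le_trans (enorm_triangle _ (z i) _) _.
rewrite yhz enormZ mulrDl mul1r lerD //; apply: ler_pM; rewrite ?enorm_ge0 //.
case/andP: lambda01; rewrite -/kap => l0 l1; rewrite ler_norml lerBrDr addNr l0 /=.
by rewrite lerBlDr ler_wpDr.
Qed.

Let dd_le i c : (i < m)%N -> enorm (yh i - z 0%N) <= c -> enorm (dd i) <= g + L * c.
Proof.
move=> im hc; rewrite enormZ ger0_norm ?invr_ge0 // ler_pdivrMl // -(block_const nbm _ im).
apply: le_trans (enorm_sum _ _ _) _; apply: ler_sum => j _.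
have := enormD (grad (fi (s j)) (yh i) - grad (fi (s j)) (z 0%N)) (grad (fi (s j)) (z 0%N)).
rewrite subrK => /le_trans; apply; rewrite addrC; apply: lerD (hg _) _.
exact: le_trans (lipfi _ _ _) (ler_wpM2l (ltW L0) hc).
Qed.

Lemma drift_bound i : (i <= m)%N ->
  enorm (u i) <= drift i * S /\ enorm (z i - z 0%N) <= drift i * S.
Proof.
elim: i => [|i IH] im.
  by rewrite subrr enorm0 /= mul1r; split; rewrite ?S0 // lerDl mulr_ge0 // ltW.
have [hu hz] := IH (ltnW im).
have hd := dd_le im (yh_dist hu hz).
have dS := mulr_ge0 (drift_ge0 i) S0.
have ald : al * enorm (dd i) <= (1 + L * (kap + 1) * drift i) * S.
  apply: le_trans (ler_wpM2l (ltW al0) hd) _.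
  have t0 : 0 <= L * ((kap + 1) * (drift i * S)).
    exact: mulr_ge0 (ltW L0) (mulr_ge0 (addr_ge0 kap0 ler01) dS).
  rewrite mulrDr [leRHS]mulrDl mul1r -!mulrA; apply: lerD; last by rewrite ler_piMl.
  by rewrite lerDr enorm_ge0.
have ad0 : 0 <= al * enorm (dd i) by rewrite mulr_ge0 ?enorm_ge0 // ltW.
have RE : drift i.+1 * S = drift i * S + (1 - beta)^-1 * ((1 + L * (kap + 1) * drift i) * S).
  by rewrite /= [LHS]mulrDl -[X in _ + X]mulrA.
have X0 := le_trans ad0 ald.
rewrite RE; split.
  rewrite uS //; apply: le_trans (enormD _ _) _; rewrite enormN (enormZ beta) (enormZ al).
  rewrite (ger0_norm beta0) (ger0_norm (ltW al0)); apply: lerD.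
    have b1 : beta <= 1 by apply: ltW; case/andP: beta01.
    by apply: le_trans (ler_wpM2l beta0 hu) _; rewrite ler_piMl.
  by apply: le_trans ald _; rewrite ler_peMl.
rewrite zS // addrAC; apply: le_trans (enormD _ _) _; rewrite enormN enormZ.
apply: lerD => //.
rewrite ger0_norm; last by rewrite divr_ge0 // ltW.
have -> : al / (1 - beta) * enorm (dd i) = (1 - beta)^-1 * (al * enorm (dd i)).
  by rewrite mulrA [_ * al]mulrC.
by apply: ler_wpM2l => //; rewrite invr_ge0 ltW.
Qed.

Let C := L * (kap + 1) * drift m.

Let yh_le i : (i < m)%N -> enorm (yh i - z 0%N) <= (kap + 1) * drift m * S.
Proof.
move=> im; have [hu hz] := drift_bound (ltnW im).
apply: le_trans (yh_dist hu hz) _; rewrite mulrA ler_wpM2r //.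
by rewrite ler_wpM2l ?addr_ge0 // drift_le // ltnW.
Qed.

(** With all gradients frozen at [z 0] the blocks exhaust the components, the permutation disappears
    by reindexing, and the epoch is an exact gradient step. The error is the Lipschitz cost of the
    drift. *)
Lemma epoch_gradient :
  enorm (z m - z 0%N + (al * m%:R / (1 - beta)) *: grad f (z 0%N))
  <= al * m%:R / (1 - beta) * (C * S).
Proof.
have zE k : (k <= m)%N -> z k - z 0%N = - (al / (1 - beta)) *: \sum_(i < k) dd i.
  elim: k => [|k IH] km; first by rewrite subrr big_ord0 scaler0.
  by rewrite zS // addrAC IH ?(ltnW km) // big_ord_recr /= scalerDr !scaleNr.
have mb : m%:R / n%:R = b%:R^-1 :> R.
  have m0 : (0 < m)%N by move: n0; rewrite nbm muln_gt0 => /andP[].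
  by rewrite nbm natrM; field; rewrite !pnatr_eq0 -!lt0n b0 m0.
have gE : m%:R *: grad f (z 0%N) =
    b%:R^-1 *: \sum_(i < m) \sum_(j < n | (i * b <= j < i.+1 * b)%N) grad (fi (s j)) (z 0%N).
  rewrite (block_partition b0 nbm (fun j => grad (fi (s j)) (z 0%N))).
  rewrite grad_mean // scalerA mb; congr (_ *: _).
  by rewrite [LHS](reindex_inj (@perm_inj _ s)).
have a0 : 0 <= al / (1 - beta) by rewrite divr_ge0 // ltW.
have aE : al * m%:R / (1 - beta) = al / (1 - beta) * m%:R by rewrite mulrAC.
have -> : z m - z 0%N + (al * m%:R / (1 - beta)) *: grad f (z 0%N) =
    (al / (1 - beta)) *: (m%:R *: grad f (z 0%N) - \sum_(i < m) dd i).
  by rewrite zE // scalerBr scalerA aE scaleNr addrC.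
rewrite enormZ (ger0_norm a0) aE -[leRHS]mulrA; apply: ler_wpM2l => //.
rewrite gE /dd -scaler_sumr -scalerBr -sumrB enormZ ger0_norm ?invr_ge0 // ler_pdivrMl //.
apply: le_trans (enorm_sum _ _ _) _.
apply: (@le_trans _ _ (\sum_(i < m) b%:R * (C * S))); last first.
  by rewrite sumr_const card_ord -[leLHS]mulr_natl mulrCA.
apply: ler_sum => i _; rewrite -(block_const nbm _ (ltn_ord i)) -sumrB.
apply: le_trans (enorm_sum _ _ _) _; apply: ler_sum => j _.
rewrite enormB; apply: le_trans (lipfi _ _ _) _.
by rewrite /C -!mulrA ler_pM2l // !mulrA; exact: yh_le.
Qed.

Lemma epoch_momentum :
  enorm (u m) <= beta ^+ m * enorm (u 0%N) + m%:R * al * (g + C * S).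
Proof.
suff H k : (k <= m)%N ->
    enorm (u k) <= beta ^+ k * enorm (u 0%N) + k%:R * (al * (g + C * S)).
  by have := H m (leqnn m); rewrite mulrA.
elim: k => [|k IH] km; first by rewrite expr0 mul1r mul0r addr0.
have hd : enorm (dd k) <= g + C * S.
  by apply: le_trans (dd_le km (yh_le km)) _; rewrite /C -!mulrA.
have t0 : 0 <= al * (g + C * S).
  by rewrite mulr_ge0 ?(ltW al0) //; apply: le_trans hd; exact: enorm_ge0.
rewrite uS //; apply: le_trans (enormD _ _) _; rewrite enormN (enormZ beta) (enormZ al).
rewrite ger0_norm // (ger0_norm (ltW al0)) exprS -natr1 mulrDl mul1r addrA.
apply: lerD; last by rewrite ler_wpM2l // ltW.
apply: le_trans (ler_wpM2l beta0 (IH (ltnW km))) _.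
rewrite [leLHS]mulrDr; apply: lerD; first by rewrite mulrA.
rewrite ler_piMl //; first by rewrite mulr_ge0.
by apply: ltW; case/andP: beta01.
Qed.

End Epoch.

(** * From bounded partial sums to limits *)

Section Limits.
Variable R : realType.

Lemma bsum_cvgn (a : nat -> R) : (forall k, 0 <= a k.+1) ->
  bsum (fun k => a k.+1) <-> cvgn (fun N => \sum_(1 <= k < N) a k).
Proof.
move=> a0; split => [[B hB]|ca].
  apply: nondecreasing_is_cvgn.
    move=> m n mn; rewrite !big_add1; apply: (psum_le (a := fun k => a k.+1)) => //.
    by rewrite -!subn1 leq_sub2r.
  by exists B => _ [N _ <-]; rewrite big_add1.
have [M [_ hM]] := cvg_seq_bounded ca; exists (M + 1) => N.
have M1 : M < M + 1 by rewrite ltrDl.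
have := hM (M + 1) M1 N.+1 I.
by rewrite /= big_add1 /=; apply: le_trans; exact: ler_norm.
Qed.

(** Tail infima increase to the liminf, so each is below [B] and each tail has a term below [B]. *)
Lemma limn_einf_recur (u : nat -> R) : (limn_einf (fun k => (u k)%:E) < +oo)%E ->
  exists B, forall K, exists2 k, (K <= k)%N & u k <= B.
Proof.
rewrite limn_einf_lim => lu.
have [B hB] : exists B : R, (limn (einfs (fun k => (u k)%:E)) < B%:E)%E.
  case: (limn _) lu => [r _| //|_]; first by exists (r + 1); rewrite lte_fin ltrDl.
  by exists 0; rewrite ltNyr.
exists B => K.
have : (einfs (fun k => (u k)%:E) K < B%:E)%E.
  apply: le_lt_trans hB.
  rewrite (cvg_lim _ (ereal_nondecreasing_cvgn (@nondecreasing_einfs R _))) //.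
  by apply: ereal_sup_ubound; exists K.
move/ereal_inf_lt => [_ [k /= Kk <-]]; rewrite lte_fin => h.
by exists k => //; exact: ltW.
Qed.

Lemma bsum_cvg_rV d (v : nat -> 'rV[R]_d) : bsum (fun k => enorm (v k.+1 - v k)) ->
  exists l : 'rV[R]_d, v @ \oo --> l.
Proof.
move=> vS; have e0 k : 0 <= enorm (v k.+1 - v k) by exact: enorm_ge0.
have dist n m : (n <= m)%N -> enorm (v m - v n) <= \sum_(n <= k < m) enorm (v k.+1 - v k).
  elim: m => [|m IH]; first by rewrite leqn0 => /eqP ->; rewrite subrr enorm0 big_geq.
  rewrite leq_eqVlt ltnS => /predU1P[->|nm]; first by rewrite subrr enorm0 big_geq.
  rewrite big_nat_recr //=; apply: le_trans (enorm_triangle _ (v m) _) _.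
  by rewrite [leRHS]addrC lerD2l IH.
have : cvg (v @ \oo).
  apply: cauchy_cvg; apply: cauchy_exP => eps eps0 /=.
  have [K hK] := bsum_tail e0 vS eps0; exists (v K).
  exists K => // n /= Kn; rewrite -ball_normE /= distrC.
  apply: le_lt_trans (mxnorm_le_enorm _) _; apply: le_lt_trans (dist _ _ Kn) _.
  exact: hK.
by move=> cv; exists (lim (v @ \oo)).
Qed.

(** A positive value at the limit would keep G (v k) above half of it eventually, and [a] would be
    summable. *)
Lemma lipschitz_limit0 d (G : 'rV[R]_d -> R) (L : R) (a : nat -> R)
    (v : nat -> 'rV[R]_d) (l : 'rV[R]_d) :
  0 < L -> (forall x, 0 <= G x) -> (forall x y, `|G x - G y| <= L * enorm (x - y)) ->
  (forall k, 0 < a k) ->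
  (forall eps, 0 < eps -> exists N, forall k, (N <= k)%N -> enorm (v k - l) < eps) ->
  bsum (fun k => a k * G (v k)) -> ~ bsum a -> G l = 0.
Proof.
move=> L0 G0 lipG a0 vl aG na; apply/eqP; rewrite eq_le G0 andbT leNgt; apply/negP => Gl.
have h0 : 0 < G l / 2 / L by rewrite !divr_gt0.
have [N hN] := vl _ h0.
have Gv k : (N <= k)%N -> G l / 2 <= G (v k).
  move=> /hN; rewrite (ltr_pdivlMr _ _ L0) => h.
  by have := lipG (v k) l; rewrite ler_norml => /andP[]; lra.
apply: na; apply/(bsum_shift N) => [k|]; first exact: ltW.
have g2 : 0 <= (G l / 2)^-1 by rewrite invr_ge0 divr_ge0 // ltW.
have aG' : bsum (fun k => a (N + k)%N * G (v (N + k)%N)).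
  by apply/(bsum_shift (a := fun k => a k * G (v k)) N) => // k; rewrite mulr_ge0 // ltW.
apply: bsumW (bsumZ g2 aG') => k; rewrite mulrC ler_pdivlMr ?divr_gt0 //.
by rewrite ler_wpM2l ?(ltW (a0 _)) // Gv // leq_addr.
Qed.

(** The root of the minimum times a late block of weights is at most the tail of the series of a w.
    As the weights diverge, that block eventually makes up at least half of their total. *)
Lemma min_weighted_cvg0 (a w : nat -> R) (w0 : R) :
  (forall k, 0 < a k) -> (forall k, 0 <= w k) -> 0 <= w0 ->
  (fun N => \sum_(0 <= k < N) a k) @ \oo --> +oo ->
  bsum (fun k => a k * w k) ->
  (fun T => (\sum_(0 <= k < T) a k) ^+ 2 * \big[Num.min/w0]_(0 <= k < T) w k ^+ 2)
    @ \oo --> (0 : R).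
Proof.
move=> a0 wp w00 aoo aw; apply/cvgr0Pnorm_lt => eps eps0.
pose eta := Num.min 1 (eps / 8).
have eta0 : 0 < eta by rewrite lt_min ltr01 divr_gt0.
have etaE : 4 * eta ^+ 2 < eps.
  have h1 : eta <= 1 by rewrite ge_min lexx.
  have h2 : eta <= eps / 8 by rewrite ge_min lexx orbT.
  nra.
have aw0 k : 0 <= a k * w k by rewrite mulr_ge0 // ltW.
have [K hK] := bsum_tail aw0 aw eta0.
have /cvgryPge/(_ (2 * \sum_(0 <= k < K) a k)) := aoo.
move=> aK; near=> T.
have KT : (K <= T)%N by near: T; exists K.
have AT : 2 * \sum_(0 <= k < K) a k <= \sum_(0 <= k < T) a k by near: T.
set A := \sum_(0 <= k < T) a k in AT *.
set mu := \big[Num.min/_]_(_ <= _ < _) _.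
have mu0 : 0 <= mu by apply: le_bigmin => // k _; exact: sqr_ge0.
have mule k : (k < T)%N -> Num.sqrt mu <= w k.
  move=> kT; rewrite -(ger0_norm (wp k)) -sqrtr_sqr ler_wsqrtr // /mu big_mkord.
  exact: (bigmin_le _ (Ordinal kT) (fun k : 'I_T => w k ^+ 2)).
have A0 : 0 <= A by apply: sumr_ge0 => k _; exact: ltW.
have sA : Num.sqrt mu * \sum_(K <= k < T) a k < eta.
  apply: le_lt_trans (hK K T (leqnn K)); rewrite mulr_sumr !big_nat.
  apply: ler_sum => k /andP[_ kT]; rewrite mulrC ler_wpM2l ?mule //; exact: ltW.
have AE : A = \sum_(0 <= k < K) a k + \sum_(K <= k < T) a k by exact: big_cat_nat.
have s0 := sqrtr_ge0 mu.
have sA2 : Num.sqrt mu * A <= 2 * eta.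
  have : Num.sqrt mu * A <= Num.sqrt mu * (2 * \sum_(K <= k < T) a k).
    by rewrite ler_wpM2l //; lra.
  lra.
rewrite ger0_norm ?mulr_ge0 ?sqr_ge0 //; apply: le_lt_trans etaE.
have -> : A ^+ 2 * mu = (Num.sqrt mu * A) ^+ 2 by rewrite exprMn sqr_sqrtr // mulrC.
have -> : 4 * eta ^+ 2 = (2 * eta) ^+ 2 by ring.
by rewrite ler_sqr ?nnegrE // mulr_ge0 // ltW.
Unshelve. all: by end_near. Qed.

Lemma min_weighted_cvg0_from1 (a w : nat -> R) (w0 : R) :
  (forall k, 0 < a k.+1) -> (forall k, 0 <= w k) -> 0 <= w0 ->
  (fun N => \sum_(1 <= k < N) a k) @ \oo --> +oo ->
  bsum (fun k => a k.+1 * w k.+1) ->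
  (fun T => (\sum_(1 <= k < T.+1) a k) ^+ 2 *
            \big[Num.min/w0]_(1 <= k < T.+1) w k ^+ 2) @ \oo --> (0 : R).
Proof.
move=> a0 wp w00 aoo aw.
under eq_fun do rewrite !big_add1 /=.
apply: (min_weighted_cvg0 (a := fun k => a k.+1) (w := fun k => w k.+1)) => //.
apply/cvgryPge => A; have /cvgryPge/(_ A) := aoo.
apply: filterS => N /le_trans; apply; rewrite big_add1.
by apply: (psum_le (a := fun k => a k.+1)) (leq_pred N) => k; exact: ltW.
Qed.

End Limits.

(** * Descent along inexact gradient steps and over one epoch *)

Section DescentStep.
Variables (R : realType) (d : nat) (f : 'rV[R]_d -> R) (L : R).
Hypothesis df : forall x, differentiable f x.
Hypothesis L0 : 0 < L.
Hypothesis lipf : forall u v, enorm (grad f u - grad f v) <= L * enorm (u - v).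

(** Expanding the squared error bounds the inner product of gradient and displacement, with gains
    a/2 |grad f|^2 and |v - u|^2/(2a). Half of the latter absorbs the Taylor term, since L a <=
    1/4. *)
Lemma perturbed_descent (u v : 'rV[R]_d) (a E : R) : 0 < a -> L * a <= 4^-1 -> 0 <= E ->
  enorm (v - u + a *: grad f u) <= a * E ->
  f v <= f u - (a / 2 * enorm (grad f u) ^+ 2 + enorm (v - u) ^+ 2 / (4 * a)) + a / 2 * E ^+ 2.
Proof.
move=> a0 La E0 hE.
have := taylor_bound df L0 lipf u v; rewrite ler_norml => /andP[_].
have : enorm (v - u + a *: grad f u) ^+ 2 <= (a * E) ^+ 2.
  by rewrite ler_sqr ?nnegrE ?enorm_ge0 // mulr_ge0 // ltW.
move: (v - u) (grad f u) {hE} => w g.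
rewrite sqr_enorm dotvDl !dotvDr !dotvZl !dotvZr -!sqr_enorm (dotvC w).
move: (dotv _ _) (enorm w) (enorm g) (f u) (f v) => p D G x y h1 h2.
have La2 : L * D ^+ 2 <= D ^+ 2 / (4 * a).
  rewrite ler_pdivlMr ?mulr_gt0 //; have := ler_wpM2l (sqr_ge0 D) La; lra.
have : p <= a / 2 * E ^+ 2 - D ^+ 2 / (2 * a) - a / 2 * G ^+ 2.
  have -> : a / 2 * E ^+ 2 - D ^+ 2 / (2 * a) - a / 2 * G ^+ 2 =
    ((a * E) ^+ 2 - D ^+ 2 - a * (a * G ^+ 2)) / (2 * a) by field; rewrite gt_eqF.
  rewrite ler_pdivlMr ?mulr_gt0 //; lra.
have : D ^+ 2 / (2 * a) = D ^+ 2 / (4 * a) * 2 by field; rewrite gt_eqF.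
by move=> ->; move: La2; move: (D ^+ 2 / (4 * a)) => t; lra.
Qed.

End DescentStep.

Section RRMDescent.
Variables (R : realType) (d n b m : nat) (fi : 'I_n -> 'rV[R]_d -> R) (L fbar : R).
Variables (alpha : nat -> R) (beta lambda : R) (pi : nat -> 'S_n).
Variables (x xt : nat -> 'rV[R]_d) (y : nat -> nat -> 'rV[R]_d).
Hypothesis n0 : (0 < n)%N.
Hypothesis b0 : (0 < b)%N.
Hypothesis nbm : n = (b * m)%N.
Hypothesis dfi : forall i v, differentiable (fi i) v.
Hypothesis L0 : 0 < L.
Hypothesis lipfi : forall i u v, enorm (grad (fi i) u - grad (fi i) v) <= L * enorm (u - v).
Hypothesis fige : forall i v, fbar <= fi i v.
Hypothesis beta01 : 0 <= beta < 1.
Hypothesis lambda01 : 0 <= lambda <= beta / (1 - beta).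
Hypothesis al_gt0 : forall k, (1 <= k)%N -> 0 < alpha k.
Hypothesis al_dec : forall k, (1 <= k)%N -> alpha k.+1 <= alpha k.
Hypothesis rrm : @RRM R d n b m fi alpha beta lambda pi x xt y.

Let f := fun v : 'rV[R]_d => n%:R^-1 * \sum_(i < n) fi i v.
Let z := fun k => (1 - beta)^-1 *: x k - (beta / (1 - beta)) *: xt k.
Let U k := enorm (x k - xt k).
Let F k := f (z k) - fbar.

Lemma rrm_descent : exists al0 q C M kp C3 : R,
  [/\ 0 < al0, al0 <= 1, 0 <= q < 1, 0 <= C & 0 <= M] /\ 0 < kp /\ 0 <= C3 /\
  forall k, (1 <= k)%N -> alpha k <= al0 ->
    U k.+1 <= q * U k + C * alpha k * Num.sqrt (F k) /\
    F k.+1 + M * alpha k.+1 * U k.+1 ^+ 2 <= F k + M * alpha k * U k ^+ 2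
      - (kp * alpha k / 2 * enorm (grad f (z k)) ^+ 2
         + enorm (z k.+1 - z k) ^+ 2 / (4 * (kp * alpha k)))
      + C3 * alpha k ^+ 3 * F k.
Proof.
have m0 : (0 < m)%N by move: n0; rewrite nbm muln_gt0 => /andP[].
have mR : 0 < m%:R :> R by rewrite ltr0n.
have [be0 be1] := andP beta01.
have ob : 0 < 1 - beta by rewrite subr_gt0.
pose kap := beta / (1 - beta).
have kap0 : 0 <= kap by rewrite divr_ge0 // ltW.
pose Cd := L * (kap + 1) * drift L beta m.
have Cd0 : 0 <= Cd.
  apply: mulr_ge0; last exact: drift_ge0.
  by apply: mulr_ge0; [exact: ltW|rewrite addr_ge0].
(* From [sqr_grad_le] and [component_gap]: each component gradient at z is at most c sqrt(F). *)
pose c := Num.sqrt (4 * L * n%:R).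
have c0 : 0 <= c by exact: sqrtr_ge0.
have cE : c ^+ 2 = 4 * L * n%:R by rewrite sqr_sqrtr // !mulr_ge0 // ltW.
pose bm := beta ^+ m.
have bm0 : 0 <= bm by rewrite exprn_ge0.
have bm1 : bm < 1 by rewrite exprn_ilt1 // -lt0n.
pose q := (1 + bm) / 2.
have q0 : 0 <= q by rewrite /q; lra.
have q1 : q < 1 by rewrite /q; lra.
have dq : 0 < 1 - q by lra.
pose C := m%:R * (1 + Cd) * c.
have C0 : 0 <= C by rewrite !mulr_ge0 // addr_ge0.
(* Length of the gradient step made by one epoch, per unit of [alpha]. *)
pose kp := m%:R / (1 - beta).
have kp0 : 0 < kp by rewrite divr_gt0.
pose M := kp * Cd ^+ 2 / (1 - q).
have M0 : 0 <= M by rewrite divr_ge0 ?(ltW dq) // mulr_ge0 ?sqr_ge0 // ltW.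
pose C3 := kp * Cd ^+ 2 * c ^+ 2 + M * C ^+ 2 / (1 - q).
have C30 : 0 <= C3.
  apply: addr_ge0.
    by apply: mulr_ge0 (sqr_ge0 _); apply: mulr_ge0 (sqr_ge0 _); exact: ltW.
  by rewrite divr_ge0 ?(ltW dq) // mulr_ge0 ?sqr_ge0.
have D1 : 0 < 4 * (L * kp) by do 2 apply: mulr_gt0 => //.
have D2 : 0 < m%:R * Cd + 1 by rewrite ltr_wpDl // mulr_ge0.
(* The three bounds serve the drift, the descent step and the contraction of the momentum, in this
   order; the added 1 keeps the last denominator positive. *)
pose al0 := Num.min 1 (Num.min (4 * (L * kp))^-1 ((1 - bm) / 2 / (m%:R * Cd + 1))).
exists al0, q, C, M, kp, C3; split.
  split => //; last by rewrite q0.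
    rewrite !lt_min ltr01 invr_gt0 D1 divr_gt0 // divr_gt0 // subr_gt0 //.
  by rewrite ge_min lexx.
split => //; split => // k k1; rewrite !le_min => /and3P[a1 a2 a3].
have ak := al_gt0 k1.
have ak2 : L * (kp * alpha k) <= 4^-1.
  by move: a2; rewrite -[leRHS]mul1r ler_pdivlMr //; lra.
have ak3 : m%:R * Cd * alpha k <= (1 - bm) / 2.
  by move: a3; rewrite ler_pdivlMr //; lra.
have [_ /(_ k k1)[yk0 yk1 yS yxt yx]] := rrm.
pose sF := Num.sqrt (F k).
have fge := mean_ge n0 fige.
have F0 : 0 <= F k by rewrite subr_ge0; exact: fge.
have sF0 : 0 <= sF by exact: sqrtr_ge0.
have sFE : sF ^+ 2 = F k by rewrite sqr_sqrtr.
have al01 : 0 < alpha k <= 1 by rewrite ak.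
have zk0 : (1 - beta)^-1 *: y k 1%N - beta / (1 - beta) *: y k 0%N = z k by rewrite yk0 yk1.
have zkm : (1 - beta)^-1 *: y k m.+1 - beta / (1 - beta) *: y k m = z k.+1 by rewrite /z yxt yx.
have hg j : enorm (grad (fi j) ((1 - beta)^-1 *: y k 1%N - beta / (1 - beta) *: y k 0%N)) <= c * sF.
  rewrite zk0 -ler_sqr ?nnegrE ?enorm_ge0 ?mulr_ge0 // exprMn cE sFE.
  apply: le_trans (sqr_grad_le (dfi j) L0 (lipfi j) (z k) (fige j)) _.
  rewrite -[leRHS]mulrA ler_wpM2l ?mulr_ge0 ?(ltW L0) //.
  exact: component_gap.
have hy i : (i < m)%N -> y k i.+2 = y k i.+1 - alpha k *: (b%:R^-1 *:
    \sum_(j < n | (i * b <= j < i.+1 * b)%N)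
      grad (fi (pi k j)) (y k i.+1 + lambda *: (y k i.+1 - y k i)))
    + beta *: (y k i.+1 - y k i).
  by move=> im; have := yS i.+1; rewrite im; apply.
have eg := epoch_gradient n0 b0 nbm dfi L0 lipfi beta01 lambda01 al01 hy hg.
have em := epoch_momentum n0 b0 nbm L0 lipfi beta01 lambda01 al01 hy hg.
rewrite zk0 zkm -/Cd in eg; rewrite -yx -yxt yk0 yk1 -/(U _) -/(U k) -/Cd in em.
have akp : alpha k * m%:R / (1 - beta) = kp * alpha k by rewrite /kp [RHS]mulrAC [m%:R * _]mulrC.
rewrite akp yk0 yk1 -/(U k) in eg.
have U0 j : 0 <= U j by exact: enorm_ge0.
have E0 : 0 <= Cd * (U k + alpha k * (c * sF)).
  by rewrite mulr_ge0 // addr_ge0 // mulr_ge0 ?(ltW ak) // mulr_ge0.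
have hU : U k.+1 <= q * U k + C * alpha k * sF.
  by apply: momentum_step => //; exact: ltW.
split => //.
pose X := kp * alpha k / 2 * enorm (grad f (z k)) ^+ 2
    + enorm (z k.+1 - z k) ^+ 2 / (4 * (kp * alpha k)).
pose Y := kp * alpha k / 2 * (Cd * (U k + alpha k * (c * sF))) ^+ 2.
have hF : f (z k.+1) <= f (z k) - X + Y.
  exact: (perturbed_descent (diff_mean dfi) L0 (lip_mean dfi n0 lipfi)
    (mulr_gt0 kp0 ak) ak2 E0 eg).
rewrite -sFE; apply: (@lyapunov_step R q C M kp Cd c _ _ (U k) _ _ _ X) => //; first exact: al_dec.
rewrite sFE /F -/Y lerBlDr; apply: le_trans hF _.
by move: (f (z k)) X Y => A X Y; lra.
Qed.

End RRMDescent.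

Theorem theorem6p3 (R : realType) (d n b m : nat)
  (fi : 'I_n -> 'rV[R]_d -> R) (L fbar : R)
  (alpha : nat -> R) (beta lambda : R) (pi : nat -> 'S_n)
  (x xt : nat -> 'rV[R]_d) (y : nat -> nat -> 'rV[R]_d) :
  (0 < n)%N -> (0 < b)%N -> n = (b * m)%N ->
  (* f := (1/n) sum_i f_i *)
  let f := fun v : 'rV[R]_d => n%:R^-1 * \sum_(i < n) fi i v in
  (* each f_i is C^1 *)
  (forall i, C1 (fi i)) ->
  (* (A.a) *)
  0 < L ->
  (forall i u v, enorm (grad (fi i) u - grad (fi i) v) <= L * enorm (u - v)) ->
  (forall i v, fbar <= fi i v) ->
  (* (A.b) *)
  (forall k, (1 <= k)%N -> alpha k.+1 <= alpha k) ->
  (* definability *)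
  definable_ominimal f ->
  0 <= beta < 1 ->
  0 <= lambda <= beta / (1 - beta) ->
  (forall k, (1 <= k)%N -> 0 < alpha k) ->
  (forall k, (1 <= k)%N ->
     alpha k <= (1 - beta) * (1 - beta ^+ m) / (4 * L * m%:R)) ->
  ((fun N => \sum_(1 <= k < N) alpha k) @ \oo --> +oo) ->
  (exists xi : R, 0 < xi < 1 /\
     cvgn (fun N => \sum_(1 <= k < N) alpha k `^ (1 + xi))) ->
  @RRM R d n b m fi alpha beta lambda pi x xt y ->
  (limn_einf (fun k => (enorm (x k))%:E) < +oo)%E ->
  let z := fun k => (1 - beta)^-1 *: x k - (beta / (1 - beta)) *: xt k in
  (* (a) *)
  ((exists xstar : 'rV[R]_d, x @ \oo --> xstar /\ grad f xstar = 0) /\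
   cvgn (fun N => \sum_(1 <= k < N) enorm (z k.+1 - z k))) /\
  (* (b) *)
  (cvgn (fun N => \sum_(1 <= k < N) alpha k * enorm (grad f (x k))) /\
   ((fun T => (\sum_(1 <= k < T.+1) alpha k) ^+ 2 *
              \big[Num.min/enorm (grad f (x 1%N)) ^+ 2]_(1 <= k < T.+1)
                 enorm (grad f (x k)) ^+ 2) @ \oo --> 0)).
Proof.
move=> n0 b0 nbm f C1f L0 lipfi fige al_dec deff beta01 lambda01 al_gt0 _ al_oo
  [xi [xi01 al_cvg]] rrm xinf z.
have dfi i v : differentiable (fi i) v by case: (C1f i).
have df v : differentiable f v by exact: diff_mean.
have lipf u v : enorm (grad f u - grad f v) <= L * enorm (u - v) by exact: lip_mean.
have fge v : fbar <= f v by exact: mean_ge.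
have shift (a : nat -> R) K : (forall k, 0 <= a k) ->
    bsum (fun k => a (k + K)%N) <-> bsum a.
  move=> a0; rewrite (bsum_shift K a0).
  rewrite (_ : (fun k => a (k + K)%N) = (fun k => a (K + k)%N)) //.
  by apply/funext => k; rewrite addnC.
have alS k : 0 < alpha k.+1 by exact: al_gt0.
have al_sum : bsum (fun k => alpha k.+1 `^ (1 + xi)).
  by apply/(bsum_cvgn (a := fun k => alpha k `^ (1 + xi))) => // k; exact: powR_ge0.
have [al0 [q [C [M [kp [C3 [[al00 al01 q01 C0 M0] [kp0 [C30 step]]]]]]]]] :=
  rrm_descent n0 b0 nbm dfi L0 lipfi fige beta01 lambda01 al_gt0 al_dec rrm.
have xi1 : 0 <= 1 + xi by case/andP: xi01 => h _; rewrite addr_ge0 // ltW.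
have [K hK] : exists K, forall k, (K <= k)%N -> alpha k.+1 <= al0.
  have [K hK] := bsum_small (fun k => powR_ge0 (alpha k.+1) (1 + xi)) al_sum
    (powR_gt0 (1 + xi) al00).
  exists K => k /hK; apply: contraTT; rewrite -ltNge -leNgt => h.
  by rewrite ge0_ler_powR ?nnegrE ?(ltW h) // ltW // (lt_trans al00).
(* Skips the epochs before the step sizes fall below [al0], and passes from indices starting at 1 to
   indices starting at 0. *)
pose s k := (k + K).+1.
pose kap := beta / (1 - beta).
have kap0 : 0 <= kap.
  by case/andP: beta01 => h1 h2; rewrite divr_ge0 // subr_ge0 ltW.
pose U k := enorm (x k - xt k).
have U0 k : 0 <= U k by exact: enorm_ge0.
have zx k : z k - x k = kap *: (x k - xt k).
  apply/rowP => j; rewrite /z /kap !mxE; field.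
  by case/andP: beta01 => _ h; rewrite gt_eqF // subr_gt0.
have zx_norm k : enorm (z k - x k) = kap * U k by rewrite zx enormZ ger0_norm.
have al_gt0' k : 0 < alpha (s k) by exact: alS.
have al_le1' k : alpha (s k) <= 1 by apply: le_trans al01; apply: hK; exact: leq_addl.
have al_dec' k : alpha (s k.+1) <= alpha (s k) by exact: al_dec.
have al_sum' : bsum (fun k => alpha (s k) `^ (1 + xi)).
  by apply/(shift (fun k => alpha k.+1 `^ (1 + xi)) K) => // k; exact: powR_ge0.
have stepU k := (step (s k) isT (hK (k + K)%N (leq_addl _ _))).1.
have stepF k := (step (s k) isT (hK (k + K)%N (leq_addl _ _))).2.
have [B B0 UB] := U_bounded fge al_gt0' al_le1' xi01 al_sum' (fun k => U0 (s k)) q01 C0 M0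
  kp0 C30 stepU stepF.
have [rx hrx] := limn_einf_recur xinf.
(* The liminf speaks of x; bounded momentum transfers recurrence to z. *)
have recur j : exists2 k, (j <= k)%N & enorm (z (s k)) <= rx + kap * B.
  have [k jk xk] := hrx (j + K).+1.
  have kE : s (k - K.+1)%N = k by rewrite /s -addnS subnK // (leq_trans _ jk) // ltnS leq_addl.
  exists (k - K.+1)%N; first by rewrite -(addnK K.+1 j) leq_sub2r // addnS.
  have := enormD (z k - x k) (x k); rewrite kE subrK zx_norm => /le_trans; apply.
  by rewrite addrC lerD // ler_wpM2l // -kE; exact: UB.
have [zS gS] := kl_convergence df L0 lipf deff fge al_gt0' al_le1' al_dec' xi01 al_sum'
  (fun k => U0 (s k)) q01 C0 M0 kp0 C30 stepU stepF recur.
have uS := bsum_alU fge al_gt0' al_le1' al_dec' xi01 al_sum' (fun k => U0 (s k)) q01 C0 M0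
  kp0 C30 stepU stepF.
have u2S := bsum_U2 fge al_gt0' al_le1' xi01 al_sum' (fun k => U0 (s k)) q01 M0
  kp0 C30 stepU stepF.
(* The finitely many skipped epochs are put back. *)
have {}zS : bsum (fun k => enorm (z k.+2 - z k.+1)).
  exact: (shift (fun k => enorm (z k.+2 - z k.+1)) K (fun k => enorm_ge0 _)).1 zS.
have ag0 k : 0 <= alpha k.+1 * enorm (grad f (z k.+1)).
  exact: mulr_ge0 (ltW (alS k)) (enorm_ge0 _).
have {}gS : bsum (fun k => alpha k.+1 * enorm (grad f (z k.+1))).
  exact: (shift (fun k => alpha k.+1 * enorm (grad f (z k.+1))) K ag0).1 gS.
have {}uS : bsum (fun k => alpha k.+1 * U k.+1).
  exact: (shift (fun k => alpha k.+1 * U k.+1) K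
    (fun k => mulr_ge0 (ltW (alS k)) (U0 k.+1))).1 uS.
have {}u2S : bsum (fun k => U k.+1 ^+ 2).
  exact: (shift (fun k => U k.+1 ^+ 2) K (fun k => sqr_ge0 _)).1 u2S.
(* Passing from z to x costs L kap alpha U, which is summable. *)
have gxS : bsum (fun k => alpha k.+1 * enorm (grad f (x k.+1))).
  have := bsumD gS (bsumZ (mulr_ge0 (ltW L0) kap0) uS); apply: bsumW => k.
  rewrite mulrCA -mulrDr ler_wpM2l ?(ltW (alS k)) //.
  have := enormD (grad f (x k.+1) - grad f (z k.+1)) (grad f (z k.+1)).
  rewrite subrK => /le_trans; apply; rewrite addrC lerD2l.
  by apply: le_trans (lipf _ _) _; rewrite enormB zx_norm mulrA.
have [l zl] := bsum_cvg_rV (v := fun k => z k.+1) zS.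
have zl0 : forall eps, 0 < eps -> exists N, forall k, (N <= k)%N -> enorm (z k.+1 - l) < eps.
  move=> eps e0; have /cvg_enorm/cvgr0Pnorm_lt/(_ eps e0)[N _ hN] := zl.
  by exists N => k /hN /=; rewrite ger0_norm ?enorm_ge0.
split; split.
- exists l; split.
    apply/cvg_enorm/cvgr0Pnorm_lt => eps e0.
    have k1 : 0 < kap + 1 by rewrite ltr_wpDl.
    have h0 : 0 < eps / 2 by rewrite divr_gt0.
    have [N1 hN1] := zl0 _ h0.
    have h1 : 0 < (eps / 2 / (kap + 1)) ^+ 2 by rewrite exprn_gt0 // divr_gt0.
    have [N2 hN2] := bsum_small (fun k => sqr_ge0 (U k.+1)) u2S h1.
    exists (maxn N1 N2).+1 => // -[//|k] /=; rewrite ltnS geq_max => /andP[k1' k2'].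
    rewrite ger0_norm ?enorm_ge0 //.
    have := hN2 k k2'; rewrite ltr_sqr ?nnegrE // ?divr_ge0 ?(ltW e0) ?(ltW k1) //.
    rewrite ltr_pdivlMr // => hU.
    apply: le_lt_trans (enorm_triangle _ (z k.+1) _) _; rewrite enormB zx_norm.
    have := hN1 k k1'; have := U0 k.+1; move: (enorm _) (U k.+1) hU => t u; lra.
  apply: enorm0_eq0.
  apply: (@lipschitz_limit0 R d (fun v => enorm (grad f v)) L (fun k => alpha k.+1)
    (fun k => z k.+1) l) => //.
    by move=> u v; apply: le_trans (enorm_dist _ _) (lipf u v).
  move=> [A hA]; have /cvgryPge/(_ (A + 1))[N' _ /(_ N' (leqnn _))] := al_oo.
  by rewrite /= big_add1; have := hA N'.-1; lra.
- exact: (bsum_cvgn (a := fun k => enorm (z k.+1 - z k)) (fun k => enorm_ge0 _)).1 zS.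
- exact: (bsum_cvgn (a := fun k => alpha k * enorm (grad f (x k)))
    (fun k => mulr_ge0 (ltW (alS k)) (enorm_ge0 _))).1 gxS.
(* The default of the minimum is its k = 1 term, so for T >= 1 it does not alter the value. *)
- exact: (@min_weighted_cvg0_from1 R alpha (fun k => enorm (grad f (x k)))
    (enorm (grad f (x 1%N)) ^+ 2) alS (fun k => enorm_ge0 _) (sqr_ge0 _) al_oo gxS).
Qed.
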